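(* Let $Y\subset X$ be $\delta_0$-hyperbolic geodesic metric spaces, where $Y$ has the induced length metric from $X$ and the inclusion $\iota:Y\to X$ is a $\rho_0$-proper embedding. Let $\{B_i\}_{i\in I}$ be a locally finite collection of $k_0$-quasiconvex subsets of $X$, and let $\{A_j\}$ be a collection of subsets of $Y$ such that each $A_j$ is contained in $B_i\cap Y$ for some $i$ and each $A_j$ is $k_0$-quasiconvex in $X$ as well as in $Y$. Let $\widehat X$ be obtained from $X$ by coning the sets $B_i$ and $\widehat Y$ from $Y$ by coning the sets $A_j$ (both are hyperbolic). Suppose the inclusion $\widehat Y\to\widehat X$ satisfies Mitra's criterion. Then the inclusion $Y\to X$ admits the Cannon-Thurston (CT) map $\partial Y\to\partial X$. Moreover, this CT map is injective if and only if the CT map $\partial\widehat Y\to\partial\widehat X$ is injective.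
   Context: A geodesic metric space is $\delta$-hyperbolic if every geodesic triangle is $\delta$-slim. A subset $A$ is $k$-quasiconvex if every geodesic with endpoints in $A$ lies in the closed $k$-neighborhood of $A$. $\partial X$ is the sequential Gromov boundary: classes of sequences with $(x_m.x_n)_x\to\infty$ (Gromov products), $\{x_n\}\sim\{y_n\}$ iff $(x_m.y_n)_x\to\infty$, with its usual topology. $\rho_0$-proper embedding, $\rho_0:[0,\infty)\to[0,\infty)$: $d_X(y,y')\le M$ implies $d_Y(y,y')\le\rho_0(M)$. Locally finite: for all $z$ and $R>0$ only finitely many indices $i$ satisfy $B(z,R)\cap B_i\ne\emptyset$. Coned-off space: add for each set of the collection a cone point and join each point of the set to it by an edge of length $1$; use the natural length metric, assumed geodesic. The inclusion $\widehat Y\to\widehat X$ extends $Y\subset X$ by mapping the cone over each $A_j$ into the cone over a $B_i$ containing it. CT map: $f:Y\to X$ admits the CT map if for every $\xi\in\partial Y$ and every sequence $y_n\to\xi$ in $Y$, $\{f(y_n)\}$ converges to a point of $\partial X$ depending only on $\xi$, and the resulting map $\partial f:\partial Y\to\partial X$ is continuous. Mitra's criterion for $f:Y\to X$: given $y_0\in Y$ there is a non-negative function $M(N)\to\infty$ as $N\to\infty$ such that for every geodesic segment $\lambda$ of $Y$ outside $B(y_0,N)$, any geodesic segment in $X$ joining the endpoints of $f(\lambda)$ lies outside $B(f(y_0),M(N))$. (It implies the existence of the CT map.) *)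

(* Defs.v *)
From HB Require Import structures.
From mathcomp Require Import all_boot all_order all_algebra.
From mathcomp Require Import all_classical all_reals all_analysis.
From mathcomp Require Import lra.

Set Implicit Arguments.
Unset Strict Implicit.
Unset Printing Implicit Defensive.

Import Order.TTheory GRing.Theory Num.Theory.
Import numFieldNormedType.Exports.

Local Open Scope classical_set_scope.
Local Open Scope ring_scope.

Section Geodesics.
Context {R : realType} {T : metricType R}.
Implicit Types (x y z : T) (A S : set T) (k : R).

Definition geodesic_segment x y S := exists l : R, exists c : R -> T,
  [/\ 0 <= l, c 0 = x, c l = y,
      {in `[0, l] &, forall s t, mdist (c s) (c t) = `|s - t|}
    & S = c @` `[0, l]].

Definition closed_nbhd k A : set T :=
  [set x | (ereal_inf [set (mdist x a)%:E | a in A] <= k%:E)%E].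

Definition quasiconvex k A := forall x y S, A x -> A y ->
  geodesic_segment x y S -> S `<=` closed_nbhd k A.

End Geodesics.

Section Hyperbolicity.
Context {R : realType}.
Implicit Type T : metricType R.

Definition geodesic_space T :=
  forall x y : T, exists S, geodesic_segment x y S.

(* Quantifying over all triples of vertices and sides makes it enough to put
   a condition on one of the three sides. *)
Definition slim_triangles (delta : R) T := forall (x y z : T) Sxy Syz Sxz,
  geodesic_segment x y Sxy -> geodesic_segment y z Syz ->
  geodesic_segment x z Sxz -> Sxy `<=` closed_nbhd delta (Syz `|` Sxz).

Definition hyperbolic (delta : R) T :=
  geodesic_space T /\ slim_triangles delta T.

End Hyperbolicity.

Section GromovBoundary.
Context {R : realType}.
Implicit Type T : metricType R.

Definition gromov_product T (p x y : T) : R :=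
  (mdist x p + mdist y p - mdist x y) / 2.

(* The basepoint is quantified away: two Gromov products of the same points
   differ by at most the distance between the basepoints. *)
Definition boundary_equiv T (u v : nat -> T) := forall p : T,
  gromov_product p (u mn.1) (v mn.2) @[mn --> (\oo, \oo)] --> +oo.

Definition to_infinity T (u : nat -> T) := boundary_equiv u u.

Record boundary T := Boundary {
  boundary_class : set (nat -> T) ;
  boundary_classP : exists2 u, to_infinity u &
    boundary_class = [set v | to_infinity v /\ boundary_equiv u v] }.

Definition tends_to T (u : nat -> T) (xi : boundary T) := boundary_class xi u.

Definition liminf2 (a : nat -> nat -> R) : \bar R :=
  ereal_sup [set ereal_inf [set (a mn.1 mn.2)%:E |
                             mn in [set mn | (N <= mn.1)%N /\ (N <= mn.2)%N]]
            | N in [set: nat]].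

Definition shadow T (p : T) (xi : boundary T) (r : R) : set (boundary T) :=
  [set eta : boundary T | exists u v, [/\ tends_to u xi, tends_to v eta &
     (r%:E <= liminf2 (fun i j => gromov_product p (u i) (v j)))%E]].

(* For hyperbolic T the shadows of xi form a neighborhood basis at xi, and
   this topology does not depend on the basepoint p. *)
Definition boundary_open T (O : set (boundary T)) :=
  forall xi, O xi -> forall p : T, exists r, shadow p xi r `<=` O.

HB.instance Definition _ T := gen_eqMixin (boundary T).
HB.instance Definition _ T := gen_choiceMixin (boundary T).

Let boundary_openT T : boundary_open [set: boundary T].
Proof. by move=> xi _ p; exists 0. Qed.

Let boundary_openI T : setI_closed (@boundary_open T).
Proof.
move=> U V Uo Vo xi [Uxi Vxi] p.
have [r1 h1] := Uo _ Uxi p; have [r2 h2] := Vo _ Vxi p.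
exists (Num.max r1 r2) => eta [u [v [xu ev rle]]]; split.
  apply: h1; exists u, v; split => //; apply: le_trans rle.
  by rewrite lee_fin le_max lexx.
apply: h2; exists u, v; split => //; apply: le_trans rle.
by rewrite lee_fin le_max lexx orbT.
Qed.

Let boundary_open_bigU T (I : Type) (f : I -> set (boundary T)) :
  (forall i, boundary_open (f i)) -> boundary_open (\bigcup_i f i).
Proof.
move=> fo xi [i _ fxi] p; have [r h] := fo i _ fxi p.
by exists r => eta /h ?; exists i.
Qed.

HB.instance Definition _ T := isOpenTopological.Build (boundary T)
  (@boundary_openT T) (@boundary_openI T) (@boundary_open_bigU T).

End GromovBoundary.

Section MapsBetweenSpaces.
Context {R : realType} {Y X : metricType R}.
Implicit Type f : Y -> X.

Definition is_CT_map f (df : boundary Y -> boundary X) :=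
  (forall u xi, tends_to u xi -> tends_to (f \o u) (df xi)) /\ continuous df.

Definition admits_CT_map f := exists df, is_CT_map f df.

Definition mitra_criterion f := forall y0 : Y, exists M : R -> R,
  [/\ forall N, 0 <= N -> 0 <= M N,
      M N @[N --> +oo] --> +oo
    & forall N, 0 <= N -> forall y y' L, geodesic_segment y y' L ->
        L `&` ball y0 N = set0 ->
        forall S, geodesic_segment (f y) (f y') S ->
          S `&` ball (f y0) (M N) = set0].

Definition proper_embedding (rho : {nonneg R} -> {nonneg R}) f :=
  forall (M : {nonneg R}) y y',
    mdist (f y) (f y') <= M%:num -> mdist y y' <= (rho M)%:num.

Definition curve_length (c : R -> X) : \bar R :=
  ereal_sup [set (\sum_(0 <= n < size s)
                    mdist (c (nth 1 (0 :: s) n)) (c (nth 1 s n)))%:E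
            | s in itv_partition 0 1].

(* The metric of Y is the length metric that X induces on f(Y). *)
Definition induced_length_metric f := forall y y' : Y,
  (mdist y y')%:E = ereal_inf [set curve_length c | c in
    [set c : R -> X | [/\ {within `[0, 1], continuous c},
                          c 0 = f y, c 1 = f y' & c @` `[0, 1] `<=` range f]]].

End MapsBetweenSpaces.

Definition locally_finite {R : realType} {X : metricType R} (I : Type)
    (B : I -> set X) :=
  forall z (r : R), 0 < r -> finite_set [set i | ball z r `&` B i !=set0].

(* [cone_edge i x t] is the point at distance t from x on the edge joining
   x, in B i, to the cone point [cone_apex i]. An empty B i gets no cone
   point, as it would be at infinite distance from the rest. *)
Inductive coned_off (R : realType) (X : metricType R) (I : Type)
    (B : I -> set X) : Type :=
| cone_base (x : X)
| cone_edge (i : I) (x : X) (Bx : B i x) (t : R) (t01 : 0 < t < 1)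
| cone_apex (i : I) (B0 : B i !=set0).

Section ConedOff.
Context {R : realType} {X : metricType R} {I : Type} (B : I -> set X).
Local Notation Xh := (coned_off B).
Implicit Types p q r : Xh.

(* p lies at height s on the closed edge from x to the cone point of B i *)
Inductive on_edge (i : I) (x : X) : Xh -> R -> Prop :=
| on_edge_foot : B i x -> on_edge i x (cone_base B x) 0
| on_edge_inner (Bx : B i x) t (t01 : 0 < t < 1) :
    on_edge i x (cone_edge Bx t01) t
| on_edge_apex (B0 : B i !=set0) : B i x -> on_edge i x (cone_apex B0) 1.

Inductive cone_step : Xh -> Xh -> R -> Prop :=
| cone_step_base x y : cone_step (cone_base B x) (cone_base B y) (mdist x y)
| cone_step_edge i x p q s t :
    on_edge i x p s -> on_edge i x q t -> cone_step p q `|s - t|.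

Inductive cone_chain : Xh -> Xh -> R -> Prop :=
| cone_chain0 p : cone_chain p p 0
| cone_chainS p q r a b :
    cone_step p q a -> cone_chain q r b -> cone_chain p r (a + b).

(* The length metric of the space glued from X and the edges; X being a length
   space, chains compute it as well as curves. *)
Definition cone_dist p q : R := inf [set l | cone_chain p q l].

Let cone_step_sym p q a : cone_step p q a -> cone_step q p a.
Proof.
case=> [x y|i x {}p {}q s t ps qt]; first by rewrite metric_sym; constructor.
by rewrite distrC; apply: cone_step_edge; eassumption.
Qed.

Let cone_step1 p q a : cone_step p q a -> cone_chain p q a.
Proof.
by move=> pq; rewrite -[a]addr0; apply: cone_chainS pq _; constructor.
Qed.

Let cone_chain_cat p q r a b :
  cone_chain p q a -> cone_chain q r b -> cone_chain p r (a + b).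
Proof.
elim=> [{}p|{}p q' {}q a1 a2 st _ ih] qr; first by rewrite add0r.
by rewrite -addrA; apply: cone_chainS st _; exact: ih.
Qed.

Let cone_chain_sym p q a : cone_chain p q a -> cone_chain q p a.
Proof.
elim=> [{}p|{}p q' {}q a1 a2 st _ ih]; first by constructor.
by rewrite addrC; apply: cone_chain_cat ih _; exact/cone_step1/cone_step_sym.
Qed.

Let cone_step_lip (F : Xh -> R) :
  (forall x y, `|F (cone_base B x) - F (cone_base B y)| <= mdist x y) ->
  (forall i x p q s t, on_edge i x p s -> on_edge i x q t ->
     `|F p - F q| <= `|s - t|) ->
  forall p q a, cone_chain p q a -> `|F p - F q| <= a.
Proof.
move=> Fb Fe p q a; elim=> [{}p|{}p q' {}q a1 a2 st _ ih].
  by rewrite subrr normr0.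
rewrite -(subrK (F q') (F p)) -addrA (le_trans (ler_normD _ _))// lerD//.
by case: st => [x y|i x p1 q1 s t ps qt]; [exact: Fb|exact: Fe ps qt].
Qed.

Let cone_chain_ge0 p q a : cone_chain p q a -> 0 <= a.
Proof.
move=> pq; rewrite -(normr0 R) -(subrr (0 : R)).
apply: (cone_step_lip (F := fun=> 0)) pq => *; rewrite subrr normr0 //.
exact: mdist_ge0.
Qed.

Let cone_to_base p : exists x a, cone_chain p (cone_base B x) a.
Proof.
case: p => [x|i x Bx t t01|i [x Bx]].
- by exists x, 0; constructor.
- exists x, `|t - 0|; apply: cone_step1.
  by apply: (cone_step_edge (i := i) (x := x)); constructor.
- exists x, `|1 - 0|; apply: cone_step1.
  by apply: (cone_step_edge (i := i) (x := x)); constructor.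
Qed.

Let cone_connected p q : [set l | cone_chain p q l] !=set0.
Proof.
have [x [a pa]] := cone_to_base p; have [y [b qb]] := cone_to_base q.
exists (a + (mdist x y + b)) => /=; apply: cone_chain_cat pa _.
by apply: cone_chainS; [constructor|exact: cone_chain_sym].
Qed.

Let cone_dist_le p q a : cone_chain p q a -> cone_dist p q <= a.
Proof. by move=> pq; apply: ge_inf => //; exists 0 => b /cone_chain_ge0. Qed.

Let cone_dist_ge p q a :
  (forall b, cone_chain p q b -> a <= b) -> a <= cone_dist p q.
Proof. by move=> h; apply: lb_le_inf => //; exact: cone_connected. Qed.

Let cone_dist_lip (F : Xh -> R) :
  (forall x y, `|F (cone_base B x) - F (cone_base B y)| <= mdist x y) ->
  (forall i x p q s t, on_edge i x p s -> on_edge i x q t ->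
     `|F p - F q| <= `|s - t|) ->
  forall p q, cone_dist p q = 0 -> F p = F q.
Proof.
move=> Fb Fe p q pq0; apply/eqP; rewrite -subr_eq0 -normr_le0 -pq0.
by apply: cone_dist_ge => b; exact: cone_step_lip.
Qed.

Let cone_distxx p : cone_dist p p = 0.
Proof.
apply/eqP; rewrite eq_le cone_dist_le; last by constructor.
by rewrite cone_dist_ge// => b /cone_chain_ge0.
Qed.

Let cone_dist_sym p q : cone_dist p q = cone_dist q p.
Proof.
by congr inf; apply/seteqP; split => l /=; exact: cone_chain_sym.
Qed.

Let cone_dist_triangle q p r : cone_dist p r <= cone_dist p q + cone_dist q r.
Proof.
rewrite -lerBlDr; apply: cone_dist_ge => a pq.
rewrite lerBlDr -lerBlDl; apply: cone_dist_ge => b qr.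
by rewrite lerBlDl; apply/cone_dist_le/cone_chain_cat; eassumption.
Qed.

(* Points at distance zero are told apart by 1-Lipschitz functions. *)
Let height p : R :=
  match p with cone_base _ => 0 | cone_edge _ _ _ t _ => t | cone_apex _ _ => 1 end.

Let height_edge i x p s : on_edge i x p s -> height p = s.
Proof. by case. Qed.

Let cone_dist_height p q : cone_dist p q = 0 -> height p = height q.
Proof.
apply: cone_dist_lip => [x y|i x p1 q1 s t /height_edge -> /height_edge ->//].
by rewrite subrr normr0 mdist_ge0.
Qed.

Let from_base (z : X) p : R :=
  match p with
  | cone_base x => Num.min (mdist x z) 1
  | cone_edge _ x _ t _ => (1 - t) * Num.min (mdist x z) 1
  | cone_apex _ _ => 0
  end.

Let from_base_edge z i x p s : on_edge i x p s ->
  from_base z p = (1 - s) * Num.min (mdist x z) 1.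
Proof. by case=> //= *; rewrite ?subr0 ?mul1r // subrr mul0r. Qed.

Let cone_dist_base x y :
  cone_dist (cone_base B x) (cone_base B y) = 0 -> x = y.
Proof.
move=> xy0; suff : from_base y (cone_base B x) = from_base y (cone_base B y).
  rewrite /= mdistxx [RHS]min_l ?ler01//.
  case: (leP (mdist x y) 1) => _; first exact: mdist_positivity.
  by move/eqP; rewrite oner_eq0.
apply: cone_dist_lip xy0 => [x1 x2|i x1 p1 q1 s t h1 h2] /=.
  have t1 := metric_triangle x1 x2 y; have t2 := metric_triangle x2 x1 y.
  have := mdist_ge0 x1 x2; rewrite (metric_sym x2 x1) in t2.
  rewrite ler_norml !minEle => ge0.
  by case: ifPn => ?; case: ifPn => ?; apply/andP; split; lra.
rewrite (from_base_edge y h1) (from_base_edge y h2) -mulrBl.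
have -> : 1 - s - (1 - t) = t - s by lra.
rewrite normrM (distrC t); apply: ler_piMr => //.
have ge0 : 0 <= Num.min (mdist x1 y) 1 by rewrite le_min mdist_ge0 ler01.
by rewrite ger0_norm// ge_min lexx orbT.
Qed.

Let bump_edge (i : I) (x : X) p : R :=
  match p with
  | cone_edge j y _ t _ => if pselect (j = i /\ y = x) then Num.min t (1 - t) else 0
  | _ => 0
  end.

Let bump_edge_edge i x j y p s : on_edge j y p s ->
  0 <= s <= 1 /\ bump_edge i x p =
    if pselect (j = i /\ y = x) then Num.min s (1 - s) else 0.
Proof.
case=> [Bj|By t t01|Bj0 Bj] /=; split => //.
- by rewrite lexx ler01.
- by rewrite subr0 min_l ?ler01// if_same.
- by case/andP: t01 => *; apply/andP; split; exact: ltW.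
- by rewrite ler01 lexx.
- by rewrite subrr min_r ?ler01// if_same.
Qed.

Let cone_dist_edge i x (Bx : B i x) t (t01 : 0 < t < 1)
    j y (By : B j y) u (u01 : 0 < u < 1) :
  cone_dist (cone_edge Bx t01) (cone_edge By u01) = 0 -> j = i /\ y = x.
Proof.
move=> h0.
have : bump_edge i x (cone_edge Bx t01) = bump_edge i x (cone_edge By u01).
  apply: cone_dist_lip h0 => [? ?|k z p q s v ps qv] /=.
    by rewrite subrr normr0 mdist_ge0.
  have [/andP[s0 s1] ->] := bump_edge_edge i x ps.
  have [/andP[v0 v1] ->] := bump_edge_edge i x qv.
  case: (pselect (k = i /\ z = x)) => [?|?]; last by rewrite subrr normr0.
  have := ler_norm (s - v); have := ler_norm (v - s); rewrite (distrC v s).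
  rewrite ler_norml !minEle => ? ?.
  by case: ifPn => ?; case: ifPn => ?; apply/andP; split; lra.
move=> /=; case: (pselect (i = i /\ x = x)) => [?|[]//].
case: (pselect (j = i /\ y = x)) => [//|?].
have /andP[t0 t1] := t01.
by move/eqP; rewrite gt_eqF// lt_min t0 subr_gt0.
Qed.

Let bump_apex (i : I) p : R :=
  match p with
  | cone_base _ => 0
  | cone_edge j _ _ t _ => if pselect (j = i) then t else 0
  | cone_apex j _ => if pselect (j = i) then 1 else 0
  end.

Let bump_apex_edge i j y p s : on_edge j y p s ->
  bump_apex i p = if pselect (j = i) then s else 0.
Proof. by case=> //=; rewrite if_same. Qed.

Let cone_dist_apex i (Bi : B i !=set0) j (Bj : B j !=set0) :
  cone_dist (cone_apex Bi) (cone_apex Bj) = 0 -> j = i.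
Proof.
move=> h0; have : bump_apex i (cone_apex Bi) = bump_apex i (cone_apex Bj).
  apply: cone_dist_lip h0 => [? ?|k z p q s v ps qv] /=.
    by rewrite subrr normr0 mdist_ge0.
  rewrite (bump_apex_edge i ps) (bump_apex_edge i qv).
  by case: (pselect (k = i)) => // ?; rewrite subrr normr0.
move=> /=; case: (pselect (i = i)) => [?|[]//].
case: (pselect (j = i)) => [//|?] /eqP.
by rewrite oner_eq0.
Qed.

Let cone_dist_positivity p q : cone_dist p q = 0 -> p = q.
Proof.
move=> h0; have := cone_dist_height h0; move: h0.
case: p => [x|i x Bx t t01|i Bi]; case: q => [y|j y By u u01|j Bj] /=.
- by move=> /cone_dist_base ->.
- by move=> _ u0; exfalso; case/andP: u01; rewrite -u0 ltxx.
- by move=> _ /eqP; rewrite eq_sym oner_eq0.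
- by move=> _ t0; exfalso; case/andP: t01; rewrite t0 ltxx.
- move=> h0 tu; case: (cone_dist_edge h0) => ji yx; subst.
  by rewrite (Prop_irrelevance By Bx) (Prop_irrelevance u01 t01).
- by move=> _ t0; exfalso; case/andP: t01; rewrite t0 ltxx.
- by move=> _ /eqP; rewrite oner_eq0.
- by move=> _ u0; exfalso; case/andP: u01; rewrite -u0 ltxx.
- by move=> /cone_dist_apex ji _; subst; rewrite (Prop_irrelevance Bj Bi).
Qed.

HB.instance Definition _ := gen_eqMixin (coned_off B).
HB.instance Definition _ := gen_choiceMixin (coned_off B).
HB.instance Definition _ := isMetric.Build R (coned_off B)
  cone_distxx cone_dist_positivity cone_dist_sym cone_dist_triangle.

End ConedOff.

(* The cone over A j goes into the cone over B (phi j), each edge and the cone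
   point being mapped identically. *)
Definition coned_map (R : realType) (Y X : metricType R) (J I : Type)
    (A : J -> set Y) (B : I -> set X) (f : Y -> X) (phi : J -> I)
    (fAB : forall j, f @` A j `<=` B (phi j)) (p : coned_off A) : coned_off B :=
  match p with
  | cone_base y => cone_base B (f y)
  | cone_edge j y Ay t t01 => cone_edge (fAB j _ (imageP f Ay)) t01
  | cone_apex j A0 => cone_apex (subset_nonempty (fAB j) (image_nonempty f A0))
  end.

(* Main.v *)
Require Import Defs.
From mathcomp Require Import all_boot all_order all_algebra.
From mathcomp Require Import all_classical all_reals all_analysis.
From mathcomp Require Import lra ring zify.

(** In a hyperbolic space a geodesic stays logarithmically close to any chain
    with the same endpoints. If the sets of a family are uniformly quasiconvex,
    this also holds for chains of the coned-off space, with distances measured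
    there, so that geodesics of a space and of its coned-off space are uniformly
    close in the coned-off metric. The same argument, applied to a set that is
    quasiconvex in X and Y, shows that geodesics of X and Y with endpoints in
    this set are close, because the embedding is proper; concatenating, the same
    holds for two points of Y at bounded distance in the coned-off Y.

    A geodesic of Y that is far from y0 in Y therefore splits into two parts that
    are far from y0 in the coned-off Y, to which Mitra's criterion applies, and
    a middle part whose endpoints are close to y0 there, which is close to a
    geodesic of X. Hence geodesics of X with the same endpoints are far from y0,
    which gives the Cannon-Thurston map.

    A sequence that tends to a point of the boundary of the coned-off space tends
    to a point of the original boundary, and on such sequences equivalence in the
    two spaces is the same. A boundary point of Y that does not come from the
    coned-off Y is the limit of a sequence that is bounded there. Along such
    sequences geodesics of X and Y are close, so distinct limits are not
    identified in X; nor is such a limit identified with a point coming from the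
    coned-off Y. *)

Set Implicit Arguments.
Unset Strict Implicit.
Unset Printing Implicit Defensive.

Import Order.TTheory GRing.Theory Num.Theory.

Local Open Scope classical_set_scope.
Local Open Scope ring_scope.

(** * Metric intervals *)

Section Intervals.
Context {R : realType}.
Implicit Types (T : metricType R) (D r : R).

(* On a coned-off space the structure of R in [mdist] is only convertible to
   the usual one, which [lra] does not see through. *)
Definition dist T (x y : T) : R := mdist x y.

Lemma distxx T (x : T) : dist x x = 0.
Proof. exact: mdistxx. Qed.

Lemma dist_ge0 T (x y : T) : 0 <= dist x y.
Proof. exact: mdist_ge0. Qed.

Lemma dist_eq0 T (x y : T) : dist x y = 0 -> x = y.
Proof. exact: mdist_positivity. Qed.

Lemma dist_sym T (x y : T) : dist x y = dist y x.
Proof. exact: metric_sym. Qed.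

Lemma dist_triangle T (x y z : T) : dist x z <= dist x y + dist y z.
Proof. exact: metric_triangle. Qed.

(** In a geodesic space this says that [z] lies on some geodesic from [x] to [y], so that statements
    about all geodesics become linear relations between distances. *)
Definition btw T (x z y : T) := dist x z + dist z y = dist x y.

Definition geod T := forall (x y : T) (r : R), 0 <= r <= dist x y ->
  exists2 z, btw x z y & dist x z = r.

Definition thin D T := forall x y z p : T, btw x p y ->
  exists2 q, btw x q z \/ btw z q y & dist p q <= D.

Lemma btwC T (x z y : T) : btw x z y -> btw y z x.
Proof. by rewrite /btw addrC (dist_sym x z) (dist_sym z y) (dist_sym y x). Qed.

Lemma btw_l T (x y : T) : btw x x y.
Proof. by rewrite /btw distxx add0r. Qed.

Lemma btw_r T (x y : T) : btw x y y.
Proof. by rewrite /btw distxx addr0. Qed.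

Lemma btw_xx T (x z : T) : btw x z x -> z = x.
Proof.
rewrite /btw distxx (dist_sym z) => h; have := dist_ge0 x z => ge0.
by apply/esym/dist_eq0; lra.
Qed.

Lemma btw_sub T (x y p q : T) : btw x p y -> btw x q p -> btw x q y /\ btw q p y.
Proof.
rewrite /btw => h1 h2; have := dist_triangle x q y.
by have := dist_triangle q p y => *; split; lra.
Qed.

Lemma btw_trans T (x y p q : T) : btw x p y -> btw x q p -> btw x q y.
Proof. by move=> h1 h2; have [] := btw_sub h1 h2. Qed.

Lemma btw_mid T (x y p a b : T) :
  btw x p y -> btw x a p -> btw p b y -> btw a p b.
Proof.
rewrite /btw => h1 h2 h3; have := dist_triangle x a y.
have := dist_triangle a b y; have := dist_triangle a p b.
by move=> *; lra.
Qed.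

Lemma btw_le T (x z y : T) : btw x z y -> dist x z <= dist x y.
Proof. by rewrite /btw; have := dist_ge0 z y => *; lra. Qed.

(** The infimum need not be attained, hence the extra 1; [|k|] makes the bound nonnegative for every
    [k]. *)
Lemma closed_nbhd_near T (k : R) (A : set T) (x : T) :
  closed_nbhd k A x -> exists2 a, A a & dist x a <= `|k| + 1.
Proof.
rewrite /closed_nbhd /dist /= => h.
have : (ereal_inf [set (mdist x a)%:E | a in A] < (`|k| + 1)%:E)%E.
  apply: le_lt_trans h _; rewrite lte_fin; have := ler_norm k; lra.
by move/ereal_inf_lt => [_ [a Aa <-]]; rewrite lte_fin => /ltW; exists a.
Qed.

Lemma geodesic_segment_sym T (x y : T) S :
  geodesic_segment x y S -> geodesic_segment y x S.
Proof.
move=> [l [c [l0 c0 cl iso ->]]]; exists l, (fun t => c (l - t)); split => //.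
- by rewrite subr0.
- by rewrite subrr.
- move=> s t; rewrite !in_itv/= => hs ht; rewrite iso ?in_itv/=; [|lra|lra].
  by rewrite distrC; congr `|_|; lra.
apply/seteqP; split => _ [t /= ht <-]; exists (l - t);
  by rewrite /= ?in_itv/= ?opprB ?subrKC//; move: ht; rewrite in_itv/=; lra.
Qed.

Lemma segment_btw T (x y w : T) S : geodesic_segment x y S -> S w -> btw x w y.
Proof.
move=> [l [c [l0 <- <- iso ->]]] [t /= tl <-].
have l0m : (0 : R) \in `[0, l] by rewrite in_itv/= lexx l0.
have llm : l \in `[0, l] by rewrite in_itv/= lexx l0.
have tm : t \in `[0, l] by [].
move: tl; rewrite /btw /dist !iso//= in_itv/= => /andP[t0 tl].
rewrite !sub0r !normrN (ger0_norm t0) (ger0_norm l0) ler0_norm; lra.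
Qed.

(** Geodesics from [x] to [w] and from [w] to [y] concatenate: distances across [w] are bounded
    above through [w] and below through [x] and [y]. *)
Lemma btw_segment T (x y w : T) : geodesic_space T -> btw x w y ->
  exists c : R -> T, [/\ c 0 = x, c (dist x y) = y, c (dist x w) = w &
    {in `[0, dist x y] &, forall s t, dist (c s) (c t) = `|s - t|}].
Proof.
move=> gT xwy; have [_ [l1 [c1 [l10 c10 c1l iso1 _]]]] := gT x w.
have [_ [l2 [c2 [l20 c20 c2l iso2 _]]]] := gT w y.
have e1 : l1 = dist x w.
  by rewrite -c10 -c1l /dist iso1 ?in_itv/= ?lexx ?l10// sub0r normrN ger0_norm.
have e2 : l2 = dist w y.
  by rewrite -c20 -c2l /dist iso2 ?in_itv/= ?lexx ?l20// sub0r normrN ger0_norm.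
have e12 : dist x y = l1 + l2 by rewrite e1 e2 xwy.
pose c t := if t <= l1 then c1 t else c2 (t - l1).
have cl t : 0 <= t <= l1 -> [/\ c t = c1 t, dist x (c t) = t & dist (c t) w = l1 - t].
  move=> /andP[t0 t1]; have -> : c t = c1 t by rewrite /c t1.
  rewrite /dist -c10 -c1l !iso1 ?in_itv/= ?lexx ?l10 ?t0//.
  by rewrite sub0r normrN ger0_norm// ler0_norm ?opprB// subr_le0.
have cr t : l1 < t <= l1 + l2 ->
    [/\ c t = c2 (t - l1), dist w (c t) = t - l1 & dist (c t) y = l1 + l2 - t].
  move=> /andP[t0 t1]; have -> : c t = c2 (t - l1) by rewrite /c leNgt t0.
  have tl : (t - l1) \in `[0, l2] by rewrite in_itv/=; apply/andP; split; lra.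
  rewrite /dist -c20 -c2l !iso2 ?in_itv/= ?lexx ?l20// sub0r normrN ger0_norm; last lra.
  by rewrite ler0_norm; [split=> //; lra|lra].
exists c; split.
- by have [] := cl 0; rewrite ?lexx ?l10// => ->.
- rewrite e12 /c; case: ifPn => [h|_]; last by rewrite addrC addKr.
  have l20' : l2 = 0 by lra.
  by rewrite l20' addr0 c1l -c20 -c2l l20'.
- by have [] := cl l1; rewrite ?lexx ?l10// -e1 => ->.
have main s t : 0 <= s -> s <= t -> t <= l1 + l2 -> dist (c s) (c t) = t - s.
  move=> s0 st tl; case: (leP t l1) => t1.
    have [|-> _ _] := cl s; first by lra.
    have [|-> _ _] := cl t; first by lra.
    rewrite /dist iso1 ?in_itv/=; [|lra|lra].
    by rewrite ler0_norm; lra.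
  have [|ct wt ty] := cr t; first by lra.
  case: (leP s l1) => s1; last first.
    have [|cs ws sy] := cr s; first by lra.
    rewrite /dist ct cs iso2 ?in_itv/=; [|lra|lra].
    by rewrite ler0_norm; lra.
  have [|cs xs sw] := cl s; first by lra.
  have := dist_triangle (c s) w (c t); have := dist_triangle x (c s) y.
  have := dist_triangle (c s) (c t) y; rewrite e12 => *; lra.
move=> s t; rewrite e12 !in_itv/= => /andP[s0 sl] /andP[t0 tl].
case: (leP s t) => st.
  by rewrite main// ler0_norm; lra.
by rewrite dist_sym main ?ger0_norm//; lra.
Qed.

Lemma path_segment T (x y : T) (c : R -> T) : c 0 = x -> c (dist x y) = y ->
  {in `[0, dist x y] &, forall s t, dist (c s) (c t) = `|s - t|} ->
  geodesic_segment x y (c @` `[0, dist x y]).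
Proof. by move=> c0 cl iso; exists (dist x y), c; split => //; exact: dist_ge0. Qed.

Lemma btw_in_segment T (x y w : T) : geodesic_space T -> btw x w y ->
  exists2 S, geodesic_segment x y S & S w.
Proof.
move=> gT h; have [c [c0 cl cw iso]] := btw_segment gT h.
exists (c @` `[0, dist x y]); first exact: path_segment.
by exists (dist x w) => //=; rewrite in_itv/= dist_ge0 btw_le.
Qed.

Lemma geodesic_geod T : geodesic_space T -> geod T.
Proof.
move=> gT x y r /andP[r0 rl]; have [c [c0 cl _ iso]] := btw_segment gT (btw_l x y).
have m0 : (0 : R) \in `[0, dist x y] by rewrite in_itv/= lexx dist_ge0.
have ml : dist x y \in `[0, dist x y] by rewrite in_itv/= lexx dist_ge0.
have mr : r \in `[0, dist x y] by rewrite in_itv/= r0.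
have h1 : dist x (c r) = r by rewrite -c0 iso// sub0r normrN ger0_norm.
exists (c r) => //; rewrite /btw h1 -[X in dist (c r) X]cl iso//.
by rewrite ler0_norm; lra.
Qed.

Lemma hyperbolic_thin T delta : hyperbolic delta T -> thin (`|delta| + 1) T.
Proof.
move=> [gT sl] x y z p /(btw_in_segment gT)[Sxy hxy Sp].
have [Sxz hxz] := gT x z; have [Szy hzy] := gT z y.
have hyx : geodesic_segment y z Szy := geodesic_segment_sym hzy.
have [q hq pq] := closed_nbhd_near (sl _ _ _ _ _ _ hxy hyx hxz _ Sp).
exists q => //; case: hq => [/(segment_btw hzy)|/(segment_btw hxz)]; by [right|left].
Qed.

(** Connectedness in discrete form: walk from [x] towards [y] in unit steps until one leads into
    [Q]. *)
Lemma interval_connected T (P Q : T -> Prop) (x y : T) : geod T -> P x -> Q y ->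
  (forall z, btw x z y -> P z \/ Q z) ->
  exists p q, [/\ btw x p y, btw x q y, P p, Q q & dist p q <= 1].
Proof.
move=> gT; have [n] : exists n : nat, dist x y <= n%:R.
  by exists (Num.truncn (dist x y)).+1; exact/ltW/truncnS_gt.
elim: n x => [|n ih] x.
  by move=> h Px Qy _; exists x, y; split => //; [exact: btw_l|exact: btw_r|lra].
move=> h Px Qy PQ; have [h1|h1] := leP (dist x y) 1.
  by exists x, y; split => //; [exact: btw_l|exact: btw_r].
have [|z xzy xz] := gT x y 1; first by lra.
have [Pz|Qz] := PQ _ xzy; last first.
  by exists x, z; split => //; [exact: btw_l|lra].
have sub w : btw z w y -> btw x w y.
  by move/btwC => h2; exact/btwC/(btw_trans (btwC xzy)).
have le : dist z y <= n%:R by move: xzy; rewrite /btw xz -natr1 in h *; lra.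
have [p [q [? ? ? ? ?]]] := ih z le Pz Qy (fun w h => PQ w (sub w h)).
by exists p, q; split => //; exact: sub.
Qed.

End Intervals.

(** * Thin spaces and stability of quasigeodesics *)

Lemma gromovE {R : realType} {T : metricType R} (p x y : T) :
  gromov_product p x y = (dist x p + dist y p - dist x y) / 2.
Proof. by []. Qed.

Section ThinSpaces.
Context {R : realType} {T : metricType R} {D : R}.
Hypotheses (gT : geod T) (thT : thin D T).
Implicit Types (p q x y z u v : T) (N r : R).

(** Up to an additive constant this is a lower bound on the Gromov product, see
    [le_gromov_product_far] and [far_gromov_product]. *)
Definition far N p x y := forall q, btw x q y -> N <= dist p q.

Lemma thin_ge0 p : 0 <= D.
Proof. by have [q _] := thT p (btw_l p p); apply: le_trans; exact: dist_ge0. Qed.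

Lemma gromov_product_far p x y : far (gromov_product p x y) p x y.
Proof.
move=> q; rewrite /btw gromovE (dist_sym p) => h.
have := dist_triangle x q p; have := dist_triangle y q p.
by rewrite (dist_sym y q) => *; lra.
Qed.

(** Some point of the interval is [D]-close to [[x, p]] and [D + 1]-close to [[p, y]]; the two
    resulting estimates are added. *)
Lemma gromov_product_near p x y :
  exists2 q, btw x q y & dist p q <= gromov_product p x y + 2 * D + 1.
Proof.
have [||z xzy|z [w [xzy _ [a xap za] [b pby wb] zw]]] :=
    @interval_connected _ _ (fun z => exists2 a, btw x a p & dist z a <= D)
      (fun z => exists2 b, btw p b y & dist z b <= D) x y gT.
- by exists x; [exact: btw_l|rewrite distxx (thin_ge0 x)].
- by exists y; [exact: btw_r|rewrite distxx (thin_ge0 x)].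
- by have [q [h|h] zq] := thT p xzy; [left|right]; exists q.
exists z => //; move: xzy xap pby; rewrite /btw gromovE.
have := dist_triangle x a z; have := dist_triangle z a p.
have := dist_triangle z b y; have := dist_triangle z b p.
have := dist_triangle z w b.
rewrite (dist_sym a z) (dist_sym p b) (dist_sym p z) (dist_sym y p) (dist_sym p y).
by move=> *; lra.
Qed.

Lemma farW N N' p x y : N <= N' -> far N' p x y -> far N p x y.
Proof. by move=> NN h q /h; exact: le_trans. Qed.

Lemma le_gromov_product_far N p x y : N <= gromov_product p x y -> far N p x y.
Proof. by move=> h; exact: farW h (@gromov_product_far _ _ _). Qed.

Lemma far_gromov_product N p x y :
  far (N + 2 * D + 1) p x y -> N <= gromov_product p x y.
Proof. by move=> h; have [q /h] := gromov_product_near p x y; lra. Qed.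

(** Cut the quadrilateral into two triangles; a point close to a short side is close to its endpoint
    [u] or [v]. *)
Lemma perturb_interval r u v u' v' p : dist u u' <= r -> dist v v' <= r ->
  btw u' p v' -> exists2 q, btw u q v & dist p q <= 2 * D + r.
Proof.
move=> uu vv /(thT u)[q [u'qu|uqv'] pq].
  exists u; first exact: btw_l.
  have := btw_le (btwC u'qu); have := dist_triangle p q u.
  by have := thin_ge0 p; rewrite (dist_sym q) => *; lra.
have [q' [uq'v|vq'v'] qq'] := thT v uqv'.
  exists q' => //; have := dist_triangle p q q'; have := dist_ge0 u u'; lra.
exists v; first exact: btw_r.
have := btw_le vq'v'; have := dist_triangle p q v.
by have := dist_triangle q q' v; rewrite (dist_sym q' v) => *; lra.
Qed.

(** A point of [[x, z]] nearly realizing the product is [D]-close to [[x, y]] or [[y, z]], which are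
    at least their own product away from [p]. *)
Lemma gromov_product_4pt p x y z :
  Num.min (gromov_product p x y) (gromov_product p y z) - (3 * D + 1)
    <= gromov_product p x z.
Proof.
have [t xtz pt] := gromov_product_near p x z.
have [t' h tt] := thT y xtz; have := dist_triangle p t t'.
have : Num.min (gromov_product p x y) (gromov_product p y z) <= dist p t'.
  by rewrite ge_min; apply/orP; case: h => /gromov_product_far; [left|right].
by move=> *; lra.
Qed.

Lemma thin2 x y z w p : btw x p y ->
  exists2 q, [\/ btw x q z, btw z q w | btw w q y] & dist p q <= 2 * D.
Proof.
move=> /(thT z)[q [h|h] pq]; first by exists q; [constructor 1|have := thin_ge0 x; lra].
have [q' h' qq'] := thT w h; exists q'.
  by case: h'; [constructor 2|constructor 3].
by have := dist_triangle p q q'; lra.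
Qed.

End ThinSpaces.

(** At [m = 2 n] with [n = 2 a + b] it follows from [(n + 1)^2 <= 2^(2 n)]; a further step adds [a]
    on the left and [2^m >= a] on the right. *)
Lemma linear_le_exp2n (a b : nat) : exists m0, forall m, (m0 <= m)%N -> (a * m + b <= 2 ^ m)%N.
Proof.
have sq n : ((n.+1) ^ 2 <= 2 ^ (2 * n))%N.
  by rewrite mulnC expnM leq_exp2r//; elim: n => // n ih; rewrite expnS; lia.
exists (2 * (2 * a + b))%N; elim=> [|m ih].
  by move=> h; rewrite muln0 add0n expn0; lia.
rewrite leq_eqVlt => /orP[/eqP h|h].
  rewrite -h; have := sq (2 * a + b)%N; set n := (2 * a + b)%N => h1.
  apply: leq_trans h1; rewrite -mulnn.
  apply: (@leq_trans (n.+1 * n.+1))%N; last by [].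
  apply: (@leq_trans (n.+1 * (2 * a + b))%N); last by rewrite leq_mul.
  by rewrite -/n; nia.
have := ih h; have : (a <= 2 ^ m)%N by
  apply: (@leq_trans m); [lia|exact/ltnW/ltn_expl].
by rewrite expnS; lia.
Qed.

(** * Morse lemma for a pseudometric pulled back along a 1-Lipschitz map *)

Section Morse.
Context {R : realType} {T Z : metricType R} (F : T -> Z) (D S : R) (L : nat).
(** [F] will be the inclusion into a coned-off space or an identity map. Intervals and thinness
    refer to the metric of [T], jumps to [e]; [narrow] bounds how far an interval between [e]-close
    points strays for [e]. *)
Local Notation e x y := (dist (F x) (F y)).
Hypotheses (gT : geod T) (thT : thin D T).
Hypothesis F_lip : forall x y, e x y <= dist x y.
Implicit Types (W : T -> Prop) (n m h : nat).

Fixpoint chain W n (x y : T) : Prop :=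
  if n is n'.+1 then W x /\ exists2 x', e x x' <= L%:R & chain W n' x' y
  else W x /\ x = y.

Hypothesis narrow : forall x y q, e x y <= L%:R -> btw x q y -> e x q <= S.
Hypothesis coarse_path : forall x y n,
  e x y <= n%:R -> chain (fun=> True) n.+1 x y.

Lemma chain_start W n x y : chain W n x y -> W x.
Proof. by case: n => [|n] []. Qed.

Lemma chain_cat W n m x y z :
  chain W n x y -> chain W m y z -> chain W (n + m) x z.
Proof.
elim: n x => [|n ih] x; first by case=> _ ->.
by move=> [Wx [x' xx' h1]] h2; split => //; exists x' => //; exact: ih.
Qed.

Lemma chain_split W n m x z : chain W (n + m) x z ->
  exists2 y, chain W n x y & chain W m y z.
Proof.
elim: n x => [|n ih] x; first by move=> h; exists x => //; split => //; exact: chain_start h.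
by move=> [Wx [x' xx' /ih[y h1 h2]]]; exists y => //; split => //; exists x'.
Qed.

Lemma chain_rev W n x y : chain W n x y -> chain W n y x.
Proof.
elim: n x => [|n ih] x; first by move=> [Wx <-].
move=> [Wx [x' xx' h]]; rewrite -addn1; apply: chain_cat (ih _ h) _.
by split; [exact: chain_start h|exists x => //; rewrite dist_sym].
Qed.

Lemma sub_chain W W' n x y : (forall w, W w -> W' w) -> chain W n x y -> chain W' n x y.
Proof.
move=> WW; elim: n x => [|n ih] x; first by move=> [/WW].
by move=> [/WW ? [x' xx' /ih ?]]; split => //; exists x'.
Qed.

Lemma chain_stay W n x : W x -> chain W n x x.
Proof. by move=> Wx; elim: n => //= n ih; split => //; exists x; rewrite ?distxx. Qed.

Lemma chain_near W n x y : chain W n x y ->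
  chain (fun w => e x w <= L%:R * n%:R) n x y.
Proof.
have gen k x' : e x x' <= L%:R * k%:R -> chain W n x' y ->
    chain (fun w => e x w <= L%:R * (k + n)%:R) n x' y.
  elim: n k x' => [|n ih] k x' h /=; first by rewrite addn0 => -[].
  move=> [Wx [x2 h2 c]]; split.
    by apply: le_trans h _; rewrite ler_wpM2l// ler_nat leq_addr.
  exists x2 => //; rewrite -addSnnS; apply: ih => //.
  by have := dist_triangle (F x) (F x') (F x2); rewrite -natr1 mulrDr mulr1; lra.
by move/(gen 0%N); rewrite distxx mulr0 add0n; apply.
Qed.

(** Each halving of the chain moves [q] by at most [D], onto an interval between the ends of one
    half. After [m] halvings at most one jump remains, and [narrow] applies. *)
Lemma log_lemma W m n x y q : (n <= 2 ^ m)%N -> chain W n x y -> btw x q y ->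
  exists2 w, W w & e q w <= m%:R * D + S.
Proof.
elim: m n x y q => [|m ih] n x y q.
  move=> n1 c xqy; exists x; first exact: chain_start c.
  rewrite mul0r add0r dist_sym; case: n n1 c => [|[|//]] _ /=.
    by move=> [_ xy]; apply: narrow xqy; rewrite xy distxx.
  by move=> [_ [x' xx' [_ x'y]]]; apply: narrow xqy; rewrite -x'y.
rewrite expnS mul2n -addnn => le c xqy.
move: c; have -> : n = (minn n (2 ^ m) + (n - 2 ^ m))%N by lia.
move=> /chain_split[z c1 c2]; have [q' h qq'] := thT z xqy.
have [w Ww q'w] : exists2 w, W w & e q' w <= m%:R * D + S.
  by case: h => [/(ih _ _ _ _ _ c1)|/(ih _ _ _ _ _ c2)]; apply; lia.
exists w => //; have := dist_triangle (F q) (F q') (F w); have := F_lip q q'.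
by rewrite -natr1 mulrDl mul1r => *; lra.
Qed.

(* [Sh t a]: the point a is a position at time t of a coarse quasigeodesic
   (for the pseudometric e) from z to z'. *)
Definition quasipath (l : R) (Sh : R -> T -> Prop) (z z' : T) :=
  [/\ Sh 0 z, Sh l z', (forall t a, Sh t a -> 0 <= t <= l),
      (forall t, 0 <= t <= l -> exists a, Sh t a) &
      forall s t a b, Sh s a -> Sh t b ->
        (`|s - t| <= 1 -> e a b <= L%:R) /\ `|s - t| <= e a b + L%:R].

Section OnePath.
Variables (l : R) (Sh : R -> T -> Prop) (z z' : T).
Hypothesis Shqp : quasipath l Sh z z'.

Lemma quasipath_chain n s t a b : Sh s a -> Sh t b -> `|s - t| <= n%:R ->
  chain (fun w => exists r, Sh r w) n.+1 a b.
Proof.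
have [_ _ dom tot lip] := Shqp; elim: n s a => [|n ih] s a sa tb st.
  split; first by exists s.
  exists b; last by split => //; exists t.
  by have [+ _] := lip _ _ _ _ sa tb; apply; lra.
(* One of [n + 1] equal parts of the time: its length is at most 1 and the rest at most [n]. *)
pose r := s + (t - s) / n.+1%:R.
have n1 : (1 : R) <= n.+1%:R by rewrite ler1n.
have n0 : (0 : R) < n.+1%:R by rewrite ltr0n.
have n0' : (n.+1%:R : R) != 0 by rewrite gt_eqF.
have rt : r - t = (s - t) * (n%:R / n.+1%:R).
  rewrite /r; apply: (mulIf n0'); rewrite mulrBl mulrDl mulrA !divfK// -natr1; lra.
have inv0 : 0 <= (n.+1%:R : R)^-1 <= 1 by rewrite invr_ge0 ler0n/= invf_le1.
have dr : 0 <= r <= l.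
  have := dom _ _ sa; have := dom _ _ tb; rewrite /r.
  move: ((n.+1%:R)^-1) inv0 => c c01 *; apply/andP; split; nra.
have [a' ra'] := tot _ dr; split; first by exists s.
exists a'.
  have [+ _] := lip _ _ _ _ sa ra'; apply.
  rewrite /r opprD addNKr normrN normrM [X in _ * X]ger0_norm; last by case/andP: inv0.
  by rewrite distrC ler_pdivrMr// mul1r.
apply: (ih r) => //; rewrite rt normrM [X in _ * X]ger0_norm ?divr_ge0//.
by rewrite mulrA ler_pdivrMr// mulrC ler_wpM2l.
Qed.

Definition near (h : R) q := exists t a, Sh t a /\ e q a <= h.

Section OneStep.
Variables (h : nat) (q : T).
(** [theta] is so large that [h + 1] jumps of size [L], starting at distance [theta] from [q], stay
    at distance at least [h + 1] from [q]. *)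
Let theta : R := (L%:R + 1) * (h%:R + 2).
Let W w := h%:R + 1 <= e w q \/ exists r, Sh r w.

Let theta0 : 0 < theta.
Proof. by rewrite mulr_gt0// ?ltr_wpDl. Qed.

(* Walk from q towards z0 until the distance to q is about theta, then jump to
   the path, which is at distance h: all this happens farther than h from q. *)
Lemma detour t0 z0 : Sh t0 z0 -> (forall p, btw z0 p q -> near h%:R p) ->
  exists q1 t1 a1, [/\ btw z0 q1 q, e q1 q <= theta + 1, Sh t1 a1,
    e q1 a1 <= h%:R & chain W h.+1 q1 a1].
Proof.
(* If [z0] is already close to [q], it serves itself as the point of the path, with a constant
   chain. *)
move=> sh0 nearh; case: (leP (e z0 q) (theta + 1)) => hq.
  exists z0, t0, z0; split => //; first exact: btw_l.
    by rewrite distxx.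
  by apply: chain_stay; right; exists t0.
have [||p _|p [p' [z0p _ Pp Pp' pp']]] := @interval_connected _ _
    (fun p => theta <= e p q) (fun p => e p q < theta) z0 q gT.
- by have := theta0; lra.
- by rewrite distxx.
- by case: (leP theta (e p q)); [left|right].
have [t1 [a1 [sh1 pa1]]] := nearh _ z0p; exists p, t1, a1; split => //.
  have := dist_triangle (F p) (F p') (F q); have := F_lip p p'; lra.
apply: sub_chain (chain_near (coarse_path pa1)) => w hw; left.
have := dist_triangle (F p) (F w) (F q).
have : L%:R * h.+1%:R = L%:R * h%:R + L%:R :> R by rewrite -natr1 mulrDr mulr1.
have : (0 : R) <= L%:R by [].
move: Pp hw; rewrite /theta; move: (L%:R : R) (h%:R : R) (h.+1%:R : R) => *; lra.
Qed.

(** Detours on both sides of [q] and the stretch of path between them form a chain in [W] whose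
    length is linear in [h]. [log_lemma] finds a point of [W] close to [q]: either it is on the path
    or it is at distance at least [h + 1]. *)
Lemma improve m : btw z q z' -> (forall p, btw z p z' -> near h%:R p) ->
  (4 * h + L + 5 + 2 * (L.+1 * h.+2) <= 2 ^ m)%N ->
  h%:R + 1 <= m%:R * D + S \/ near (m%:R * D + S) q.
Proof.
move=> zqz' nearh count; have [shz shz' dom tot lip] := Shqp.
have [|q1 [t1 [a1 [zq1 qq1 sh1 qa1 c1]]]] := detour shz.
  by move=> p zp; exact/nearh/(btw_trans zqz').
have [|q2 [t2 [a2 [zq2 qq2 sh2 qa2 c2]]]] := detour shz'.
  by move=> p zp; apply/nearh/btwC/(btw_trans (btwC zqz')).
(* Bounds [e a1 a2 + L], and so [|t1 - t2|], going from [a1] to [a2] through [q1], [q] and [q2]. *)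
pose n := (2 * h + L + 2 * (L.+1 * h.+2) + 2)%N.
have c3 : chain W n.+1 a1 a2.
  apply: sub_chain (quasipath_chain sh1 sh2 _); first by right.
  have [_ h12] := lip _ _ _ _ sh1 sh2; apply: le_trans h12 _.
  have h3 := dist_triangle (F a1) (F q1) (F a2).
  have h4 := dist_triangle (F q1) (F q) (F a2).
  have h5 := dist_triangle (F q) (F q2) (F a2).
  rewrite (dist_sym (F a1) (F q1)) in h3; rewrite (dist_sym (F q) (F q2)) in h5.
  have -> : n%:R = 2 * h%:R + L%:R + 2 * theta + 2 :> R.
    by rewrite /n !natrD !natrM -!natr1 /theta; move: (h%:R : R) (L%:R : R) => *; lra.
  lra.
have c := chain_cat c1 (chain_cat c3 (chain_rev c2)).
have [|w [Ww|Ww] qw] := log_lemma (m := m) _ c (btw_mid zqz' zq1 (btwC zq2)).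
- by apply: leq_trans count; rewrite /n; lia.
- by left; apply: le_trans Ww _; rewrite dist_sym.
- by right; have [r rw] := Ww; exists r, w.
Qed.

End OneStep.

End OnePath.

(** Take [m] about [(h - S) / D]: it is linear in [h], and for large [h] its exponential exceeds any
    given linear function of [h]. *)
Lemma improve_bound : exists H : nat, forall h, (H <= h)%N -> exists m,
  (4 * h + L + 5 + 2 * (L.+1 * h.+2) <= 2 ^ m)%N /\ m%:R * D + S <= h%:R - 1.
Proof.
pose d := (Num.truncn D).+1; pose s := (Num.truncn S).+1.
have Dd : D <= d%:R by exact/ltW/truncnS_gt.
have Ss : S <= s%:R by exact/ltW/truncnS_gt.
pose a := (4 + 2 * L.+1)%N; pose b := (L + 5 + 4 * L.+1)%N.
have [m0 hm0] := linear_le_exp2n (a * d) (a * (d + s + 1) + b)%N.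
exists (s + 1 + d * m0)%N => h hh; pose m := ((h - s - 1) %/ d)%N.
have d0 : (0 < d)%N by [].
have e1 := divn_eq (h - s - 1) d; have e2 := ltn_pmod (h - s - 1) d0.
have mm : (m0 <= m)%N by rewrite leq_divRL//; lia.
exists m; split.
  apply: leq_trans (hm0 m mm).
  have hle : (h <= d * m + (d + s + 1))%N by rewrite /m; lia.
  have : (a * h <= a * (d * m + (d + s + 1)))%N by rewrite leq_mul2l hle orbT.
  by rewrite /a /b; lia.
have : (m * d + s + 1 <= h)%N by rewrite /m; lia.
rewrite -(ler_nat R) !natrD natrM => h1.
have : m%:R * D <= m%:R * d%:R by rewrite ler_wpM2l.
by move=> *; lra.
Qed.

(* If [z, z'] is in the h-neighborhood of the path with h large, then it is
   already in the (h-1)-neighborhood. *)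
Lemma geodesic_near_quasipath : exists H : R, forall l Sh z z' q,
  quasipath l Sh z z' -> btw z q z' -> near Sh H q.
Proof.
have [H hH] := improve_bound; exists H%:R => l Sh z z' q qp zqz'.
have [shz _ _ _ _] := qp.
have nearW (a b : R) p : a <= b -> near Sh a p -> near Sh b p.
  by move=> ab [t [x [h1 h2]]]; exists t, x; split => //; exact: le_trans ab.
suff [h [hH' nh]] : exists h : nat, (h <= H)%N /\ forall p, btw z p z' -> near Sh h%:R p.
  by apply: nearW (nh _ zqz'); rewrite ler_nat.
(* Some [n] works because [z] is on the path. It depends on the endpoints, but the descent from it
   ends at the uniform [H]. *)
have [n nn] : exists n : nat, forall p, btw z p z' -> near Sh n%:R p.
  exists (Num.truncn (dist z z')).+1 => p zp; exists 0, z; split => //.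
  apply: le_trans (ltW (truncnS_gt _)); rewrite dist_sym.
  exact: le_trans (F_lip _ _) (btw_le zp).
elim: n nn => [|n ih] nn; first by exists 0%N.
case: (leqP n.+1 H) => nH; first by exists n.+1.
apply: ih => p zp; have [|m [m1 m2]] := hH n.+1; first by lia.
rewrite -natr1 in m2.
by case: (improve qp zp nn m1) => [|/nearW]; [rewrite -natr1; lra|apply; lra].
Qed.

(** Points of the interval are near the path at a time before or after [t]. Where the two kinds
    meet, the times differ by at most [2 H + 1 + L], so [a] is a bounded number of jumps away. *)
Lemma quasipath_near_geodesic : exists H : R, forall l Sh z z' t a,
  quasipath l Sh z z' -> Sh t a -> exists2 q, btw z q z' & e q a <= H.
Proof.
have [H hH] := geodesic_near_quasipath.
pose n := (Num.truncn (2 * H + 1 + L%:R)).+1.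
exists (H + L%:R * n.+1%:R) => l Sh z z' t a qp ta.
have [shz shz' dom tot lip] := qp.
pose P q := exists s b, [/\ Sh s b, s <= t & e q b <= H].
pose Q q := exists s b, [/\ Sh s b, t <= s & e q b <= H].
have H0 : 0 <= H.
  have [? [? [_ h]]] := hH _ _ _ _ _ qp (btw_l z z').
  exact: le_trans (dist_ge0 _ _) h.
have /andP[t0 tl] := dom _ _ ta.
have [||p zp|p [q [zp zq]]] := @interval_connected _ _ P Q z z' gT.
- by exists 0, z; rewrite distxx.
- by exists l, z'; rewrite distxx.
- have [s [b [sb pb]]] := hH _ _ _ _ _ qp zp.
  by case: (leP s t) => st; [left|right]; exists s, b; split => //; exact: ltW.
move=> [s [b [sb st pb]]] [s' [b' [sb' st' qb']]] pq; exists p => //.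
have [_ bb'] := lip _ _ _ _ sb sb'; have := F_lip p q.
have := dist_triangle (F b) (F p) (F b'); have := dist_triangle (F p) (F q) (F b').
rewrite (dist_sym (F b) (F p)) => h1 h2 h3.
have tri := ler_norm (s' - s); rewrite distrC in tri.
have c := quasipath_chain qp sb ta (n := n).
have {}c : chain (fun w => exists r, Sh r w) n.+1 b a.
  apply: c; rewrite ler0_norm; last lra.
  apply: le_trans (ltW (truncnS_gt _)); lra.
have := chain_start (chain_rev (chain_near c)).
by have := dist_triangle (F p) (F b) (F a) => *; lra.
Qed.

End Morse.

(** * Coned-off spaces *)

(** A relation, since [c] may leave the image of [F], for instance at cone points. *)
Definition shadow_path (R : realType) (T Z : metricType R) (F : T -> Z) (l : R)
    (c : R -> Z) (t : R) (a : T) := 0 <= t <= l /\ dist (c t) (F a) <= 1.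

(** The 3 is one unit of time and an error of 1 at each end. *)
Lemma shadow_quasipath (R : realType) (T Z : metricType R) (F : T -> Z) (z z' : T)
    (c : R -> Z) :
  (forall p, exists a, dist p (F a) <= 1) ->
  c 0 = F z -> c (dist (F z) (F z')) = F z' ->
  {in `[0, dist (F z) (F z')] &, forall s t, dist (c s) (c t) = `|s - t|} ->
  quasipath F 3 (dist (F z) (F z')) (shadow_path F (dist (F z) (F z')) c) z z'.
Proof.
move=> dense c0 cl iso; set l := dist _ _ in cl iso *.
have l0 : 0 <= l by exact: dist_ge0.
split.
- by rewrite /shadow_path c0 distxx lexx l0.
- by rewrite /shadow_path cl distxx lexx l0.
- by move=> t a [].
- by move=> t tl; have [a ?] := dense (c t); exists a.
move=> s t a b [sl sa] [tl tb]; have st : dist (c s) (c t) = `|s - t|.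
  by rewrite iso// in_itv.
have := dist_triangle (F a) (c s) (F b); have := dist_triangle (c s) (c t) (F b).
have := dist_triangle (c s) (F a) (c t); have := dist_triangle (F a) (F b) (c t).
rewrite (dist_sym (F a) (c s)) (dist_sym (F b) (c t)) => *.
by split=> *; lra.
Qed.

Section ConedOff.
Context {R : realType} {X : metricType R} {I : Type} (B : I -> set X).
Local Notation Xh := (coned_off B).
Local Notation base := (cone_base B).
Implicit Types (p q : Xh) (x y z : X) (n : nat).

Lemma cone_chain_ge0 p q a : cone_chain p q a -> 0 <= a.
Proof.
elim=> // {}p q' {}q a1 a2 st _ ih; apply: addr_ge0 => //.
by case: st => *; [exact: dist_ge0|exact: normr_ge0].
Qed.

Lemma cone_chain_dist p q a : cone_chain p q a -> dist p q <= a.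
Proof. by move=> h; apply: ge_inf => //; exists 0 => b /cone_chain_ge0. Qed.

Lemma cone_step_dist p q a : cone_step p q a -> dist p q <= a.
Proof.
by move=> h; apply: cone_chain_dist; rewrite -[a]addr0; apply: cone_chainS h (cone_chain0 _).
Qed.

Lemma cone_base_lip x y : dist (base x) (base y) <= dist x y.
Proof. exact/cone_step_dist/cone_step_base. Qed.

Lemma cone_base_apex i x (Bx : B i x) (B0 : B i !=set0) :
  dist (base x) (cone_apex B0) <= 1.
Proof.
apply: cone_step_dist; have -> : 1 = `|0 - 1| :> R by rewrite sub0r normrN normr1.
by apply: (cone_step_edge (i := i) (x := x)); constructor.
Qed.

Lemma cone_same i x y : B i x -> B i y -> dist (base x) (base y) <= 2.
Proof.
move=> Bx By; have B0 : B i !=set0 by exists x.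
have := dist_triangle (base x) (cone_apex B0) (base y).
have := cone_base_apex Bx B0; have := cone_base_apex By B0.
by rewrite (dist_sym (base y)) => *; lra.
Qed.

Lemma cone_near_base p : exists x, dist p (base x) <= 1.
Proof.
case: p => [x|i x Bx t t01|i B0]; first by exists x; rewrite distxx.
  exists x; apply: (@le_trans _ _ `|t - 0|).
    by apply: cone_step_dist; apply: (cone_step_edge (i := i) (x := x)); constructor.
  by rewrite subr0 ger0_norm; lra.
by have [x Bx] := B0; exists x; rewrite dist_sym cone_base_apex.
Qed.

Lemma cone_dist_chain x y (a : R) : dist (base x) (base y) < a ->
  exists2 b, cone_chain (base x) (base y) b & b < a.
Proof.
move=> h; have hi : has_inf [set l | cone_chain (base x) (base y) l].
  split; last by exists 0 => b /cone_chain_ge0.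
  by exists (mdist x y + 0); apply: cone_chainS (cone_chain0 _); exact: cone_step_base.
have e0 : 0 < a - dist (base x) (base y) by lra.
have [b hb ba] := inf_adherent e0 hi; exists b => //.
by move: ba; rewrite -[inf _]/(dist (base x) (base y)); lra.
Qed.

(* A path from x to y in X of total length at most l, allowed to jump n times
   between two points of some B i; each jump costs 2 in the coned-off space. *)
Fixpoint route n (l : R) x y : Prop :=
  if n is n'.+1 then
    exists i a b, [/\ B i a, B i b & route n' (l - dist x a) b y]
  else dist x y <= l.

Lemma route_ge0 n l x y : route n l x y -> 0 <= l.
Proof.
elim: n l x => [|n ih] l x /=; first by apply: le_trans; exact: dist_ge0.
by move=> [i [a [b [_ _ /ih]]]]; have := dist_ge0 x a; lra.
Qed.

Lemma route_ext n l x z y : route n l z y -> route n (l + dist x z) x y.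
Proof.
case: n => [|n] /=; first by have := dist_triangle x z y; lra.
move=> [i [a [b [Ba Bb h]]]]; exists i, a, b; split => //.
have : l - dist z a <= l + dist x z - dist x a by have := dist_triangle x z a; lra.
elim: n (l - _) (l + _ - _) b h {Bb} => [|n ih] s t b /=; first exact: le_trans.
by move=> [j [a' [b' [? ? h]]]] st; exists j, a', b'; split => //; apply: ih h _; lra.
Qed.

Section Routes.
Variable y : X.

(** From height [s] on an edge a path to [y] either goes down to the foot [x], or passes the cone
    point and comes down to some [z] of [B i]; [a] bounds its cost. Induction along a chain then
    yields a route. *)
Let edge_cost i x s a :=
  (exists n l, route n l x y /\ 2 * n%:R + l + s <= a) \/
  (exists z n l, [/\ B i z, route n l z y & 2 * n%:R + l + (2 - s) <= a]).

Let cost p a :=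
  match p with
  | cone_base x => exists n l, route n l x y /\ 2 * n%:R + l <= a
  | cone_edge i x _ t _ => edge_cost i x t a
  | cone_apex i _ => exists z n l, [/\ B i z, route n l z y & 2 * n%:R + l + 1 <= a]
  end.

Let cost_edge i x p s a : on_edge i x p s -> cost p a -> edge_cost i x s a.
Proof.
case=> [Bx|//|B0 Bx] /=; first by left; under eq_exists do under eq_exists do rewrite addr0.
by move=> [z [n [l [Bz h c]]]]; right; exists z, n, l; split => //; lra.
Qed.

Let edge_cost_on i x p s a : on_edge i x p s -> edge_cost i x s a -> cost p a.
Proof.
case=> [Bx|//|B0 Bx] /= [[n [l [h c]]]|[z [n [l [Bz h c]]]]].
- by exists n, l; split => //; lra.
- exists n.+1, l; split; last by rewrite -natr1; lra.
  by exists i, x, z; rewrite distxx subr0.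
- by exists x, n, l.
- by exists z, n, l; split => //; lra.
Qed.

Let edge_cost_slide i x s t a : edge_cost i x t a -> edge_cost i x s (`|s - t| + a).
Proof.
have := ler_norm (s - t); have := ler_norm (t - s); rewrite distrC => h1 h2.
by case=> [[n [l [h c]]]|[z [n [l [Bz h c]]]]]; [left|right];
  [exists n, l|exists z, n, l]; split => //; lra.
Qed.

Let chain_cost p q a : cone_chain p q a -> q = base y -> cost p a.
Proof.
elim=> {p q a} [p ->|p q r a b st _ ih /ih {ih}].
  by exists 0%N, 0; rewrite /= distxx mulr0 addr0.
case: st => [x z|i x {}p {}q s t ps qt].
  move=> [n [l [h c]]]; exists n, (l + dist x z); rewrite -[mdist x z]/(dist x z); split; last lra.
  exact: route_ext.
by move/(cost_edge qt)/(@edge_cost_slide _ _ s)/(edge_cost_on ps).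
Qed.

Lemma cone_route x (a : R) : dist (base x) (base y) < a ->
  exists n l, route n l x y /\ 2 * n%:R + l <= a.
Proof.
move=> /cone_dist_chain[b hb ba].
have [n [l [rt c]]] := chain_cost hb erefl; exists n, l; split => //; lra.
Qed.

End Routes.

Definition interval_quasiconvex (K : R) (A : set X) := forall a b q : X,
  A a -> A b -> btw a q b -> exists2 a', A a' & dist q a' <= K.

Section Electric.
Variables (D K : R).
Hypotheses (gX : geod X) (thX : thin D X) (K0 : 0 <= K).
Hypothesis qcB : forall i, interval_quasiconvex K (B i).
Hypothesis gXh : geodesic_space Xh.

(** Each jump contributes a quadrilateral [x], [a], [b], [y]: [[x, a]] is short, [[a, b]] is close
    to [B i], of coned-off diameter at most 2, and [[b, y]] falls under the induction. *)
Lemma route_narrow n (l C : R) x y (q : X) : route n l x y -> l <= C -> btw x q y ->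
  dist (base x) (base q) <= (n.+1)%:R * (C + 2 * D + K + 2).
Proof.
move=> + + h; have D0 := thin_ge0 thX x; have k0 := K0; move: h.
set M := C + 2 * D + K + 2; elim: n l x q => [|n ih] l x q /=.
  move=> /btw_le xq /le_trans xy /xy; have := cone_base_lip x q; rewrite mul1r /M; lra.
move=> xqy [i [a [b [Ba Bb rt]]]] lC; have l0 := route_ge0 rt; have xa0 := dist_ge0 x a.
have xa := cone_base_lip x a.
have [q' h qq'] := thin2 thX a b xqy; rewrite dist_sym in qq'.
have qq := cone_base_lip q' q.
have t1 := dist_triangle (base x) (base q') (base q).
have t2 := dist_triangle (base x) (base a) (base q').
have M0 : 0 <= n.+1%:R * M by rewrite mulr_ge0// /M; lra.
rewrite -natr1 mulrDl mul1r {2}/M; case: h => h.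
- by have := cone_base_lip x q'; have := btw_le h; lra.
- have [a' Ba' qa'] := qcB Ba Bb h; have := cone_same Ba Ba'.
  have := dist_triangle (base a) (base a') (base q'); have := cone_base_lip a' q'.
  by rewrite (dist_sym a' q'); lra.
- have t3 := dist_triangle (base a) (base b) (base q').
  have := cone_same Ba Bb; have := ih _ _ _ h rt; lra.
Qed.

Lemma route_bounded x y (C : R) : dist (base x) (base y) <= C ->
  exists n l, [/\ route n l x y, (n <= (Num.truncn (C + 1)).+1)%N & 0 <= l <= C + 1].
Proof.
move=> h; have [|n [l [rt c]]] := @cone_route y x (C + 1); first by lra.
have l0 := route_ge0 rt; have n0 : (0 : R) <= n%:R by [].
exists n, l; split => //; last by apply/andP; split; lra.
by rewrite -(ler_nat R); apply: le_trans (ltW (truncnS_gt _)); lra.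
Qed.

Lemma electric_narrow (C : R) : exists S, forall x y (q : X),
  dist (base x) (base y) <= C -> btw x q y -> dist (base x) (base q) <= S.
Proof.
exists ((Num.truncn (C + 1)).+2%:R * (C + 1 + 2 * D + K + 2)) => x y q h xqy.
have [n [l [rt nN /andP[l0 lC]]]] := route_bounded h.
apply: le_trans (route_narrow rt lC xqy) _; rewrite ler_wpM2r ?ler_nat//.
by have := thin_ge0 thX x; have := K0; lra.
Qed.

(** Morse stability for [base]: points of [X] shadowing a geodesic of the coned-off space form a
    quasipath, and [electric_narrow] provides [narrow]. The final 1 is the distance between shadow
    and geodesic. *)
Lemma electric_geodesics : exists H : R, forall x y,
  (forall q : X, btw x q y -> exists2 p, btw (base x) p (base y) & dist (base q) p <= H) /\
  (forall p, btw (base x) p (base y) -> exists2 q : X, btw x q y & dist (base q) p <= H).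
Proof.
have [S hS] := electric_narrow 3%:R.
have path x w y : btw (base x) w (base y) -> exists c : R -> Xh,
    [/\ c (dist (base x) w) = w, quasipath base 3 (dist (base x) (base y))
      (shadow_path base (dist (base x) (base y)) c) x y &
      forall t, 0 <= t <= dist (base x) (base y) -> btw (base x) (c t) (base y)].
  move=> /(btw_segment gXh)[c [c0 cl cw iso]]; exists c; split => //.
    exact: shadow_quasipath cone_near_base _ _ _.
  move=> t tl; apply: (segment_btw (path_segment c0 cl iso)).
  by exists t => //=; rewrite in_itv.
have coarse x y n : dist (base x) (base y) <= n%:R -> chain base 3 (fun=> True) n.+1 x y.
  move=> h; have [c [_ qp _]] := path _ _ _ (btw_l (base x) (base y)).
  have [s0 sl _ _ _] := qp.
  apply: sub_chain (quasipath_chain qp s0 sl _) => //.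
  by rewrite sub0r normrN ger0_norm ?dist_ge0.
have [H1 near1] := geodesic_near_quasipath gX thX cone_base_lip hS coarse.
have [H2 near2] := quasipath_near_geodesic gX thX cone_base_lip hS coarse.
exists (Num.max H1 H2 + 1) => x y; split => [q xqy|p xpy].
  have [c [_ qp cb]] := path _ _ _ (btw_l (base x) (base y)).
  have [t [a [[tl ca] qa]]] := near1 _ _ _ _ _ qp xqy; exists (c t); first exact: cb.
  have := dist_triangle (base q) (base a) (c t); rewrite (dist_sym (base a) (c t)).
  have : H1 <= Num.max H1 H2 by rewrite le_max lexx.
  lra.
have [c [cp qp cb]] := path _ _ _ xpy; have [a pa] := cone_near_base p.
have [|q xqy qa] := near2 _ _ _ _ (dist (base x) p) a qp.
  by split; rewrite ?cp// dist_ge0 btw_le.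
exists q => //; have := dist_triangle (base q) (base a) p; rewrite (dist_sym (base a) p).
have : H2 <= Num.max H1 H2 by rewrite le_max lexx orbT.
lra.
Qed.

End Electric.
End ConedOff.

(** * Geodesics of X and Y *)

Lemma unit_chain (R : realType) (T : metricType R) (L n : nat) (x y : T) :
  geod T -> (0 < L)%N -> dist x y <= n%:R -> chain id L (fun=> True) n.+1 x y.
Proof.
move=> gT L0; have L1 : (1 : R) <= L%:R by rewrite ler1n.
elim: n x => [|n ih] x xy; first by split => //; exists y => //; lra.
split => //; have [z xzy xz] : exists2 z, btw x z y & dist x z = Num.min 1 (dist x y).
  by apply: gT; rewrite le_min ler01 dist_ge0 ge_min lexx orbT.
exists z; first by rewrite /= xz ge_min L1.
apply: ih; move: xzy; rewrite /btw xz -natr1 in xy *.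
by rewrite minEle; case: ifP => _; have := ler0n R n; lra.
Qed.

Section Embedding.
Context {R : realType} {X Y : metricType R} {iota : Y -> X} {D K : R}.
Hypotheses (geoX : geodesic_space X) (gY : geod Y).
Hypotheses (thX : thin D X) (thY : thin D Y).
Hypothesis iota_lip : forall y y', dist (iota y) (iota y') <= dist y y'.
Hypothesis iota_proper : forall M : R, exists r : R, forall y y',
  dist (iota y) (iota y') <= M -> dist y y' <= r.
Implicit Types (u v z w : Y) (H : R).

Let gX : geod X := geodesic_geod geoX.

Definition tracks H u v := forall p, btw (iota u) p (iota v) ->
  exists2 q, btw u q v & dist p (iota q) <= H.

Lemma tracksW H H' u v : H <= H' -> tracks H u v -> tracks H' u v.
Proof. by move=> HH h p /h[q ? ?]; exists q => //; exact: le_trans HH. Qed.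

(* Along a set that is quasiconvex in X, geodesics of X are quasigeodesics of
   Y because the embedding is proper. *)
Lemma quasiconvex_tracks : 0 <= K -> exists H, forall A : set Y,
  interval_quasiconvex K (iota @` A) -> forall z z', A z -> A z' -> tracks H z z'.
Proof.
(* Points of [A] that are [K]-close to points of the geodesic at distance at most 1 are at most
   [2 K + 1] apart in [X], hence at most [r] apart in [Y]. *)
move=> K0; have [r hr] := iota_proper (2 * K + 1).
pose L := (Num.truncn (Num.max r (2 * K))).+1.
have Lmax : Num.max r (2 * K) <= L%:R by exact/ltW/truncnS_gt.
have Lr : r <= L%:R by apply: le_trans Lmax; rewrite le_max lexx.
have LK : 2 * K <= L%:R by apply: le_trans Lmax; rewrite le_max lexx orbT.
have [H hH] := @quasipath_near_geodesic _ Y Y id D L%:R L gY thY (fun x y => lexx _)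
  (fun x y q xy xqy => le_trans (btw_le xqy) xy)
  (fun x y n => unit_chain gY (ltn0Sn _)).
exists (K + H) => A qcA z z' Az Az' p pz.
have [c [c0 cl cp iso]] := btw_segment geoX pz.
set l := dist (iota z) (iota z') in cl iso.
have l0 : 0 <= l by exact: dist_ge0.
pose Sh t a := [/\ 0 <= t <= l, A a & dist (c t) (iota a) <= K].
have tot t : 0 <= t <= l -> exists a, Sh t a.
  move=> tl; have [|_ [a Aa <-] ?] := qcA _ _ (c t) (imageP _ Az) (imageP _ Az').
    by apply: (segment_btw (path_segment c0 cl iso)); exists t; rewrite //= in_itv.
  by exists a.
have qp : quasipath id L l Sh z z'.
  split => //.
  - by split; rewrite ?lexx ?c0 ?distxx.
  - by split; rewrite ?lexx ?l0 ?cl ?distxx.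
  - by move=> t a [].
  move=> s t a b [sl _ sa] [tl _ tb].
  have st : dist (c s) (c t) = `|s - t| by rewrite iso// in_itv.
  have h1 := dist_triangle (iota a) (c s) (iota b).
  have h2 := dist_triangle (c s) (c t) (iota b).
  have h3 := dist_triangle (c s) (iota a) (c t).
  have h4 := dist_triangle (iota a) (iota b) (c t).
  rewrite (dist_sym (iota a) (c s)) in h1; rewrite (dist_sym (iota b) (c t)) in h4.
  split => [st1|]; first by apply: le_trans Lr; apply: hr; lra.
  by have := iota_lip a b; lra.
have tp : 0 <= dist (iota z) p <= l by rewrite dist_ge0 btw_le.
have [a sa] := tot _ tp; have [q zq qa] := hH _ _ _ _ _ _ qp sa.
exists q => //; have [_ _] := sa; rewrite cp => pa.
have := dist_triangle p (iota a) (iota q); have := iota_lip a q.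
by rewrite (dist_sym a q); lra.
Qed.

Lemma perturb_tracks H r u v u' v' : dist u u' <= r -> dist v v' <= r ->
  tracks H u v -> tracks (H + 4 * D + 2 * r) u' v'.
Proof.
move=> uu vv tr p pu.
have [||p' p'u pp] := perturb_interval (r := r) thX (u := iota u) (v := iota v) _ _ pu.
- exact: le_trans (iota_lip _ _) uu.
- exact: le_trans (iota_lip _ _) vv.
have [q uq p'q] := tr _ p'u.
rewrite dist_sym in uu; rewrite dist_sym in vv.
have [q' u'q' qq'] := perturb_interval thY uu vv uq; exists q' => //.
have := dist_triangle p p' (iota q'); have := dist_triangle p' (iota q) (iota q').
by have := iota_lip q q'; lra.
Qed.

(** Asking for all subintervals makes the property stable under concatenation, and lets
    [tracks_converse] cut at an intermediate point. *)
Definition all_track H z z' := forall u v, btw z u z' -> btw z v z' -> tracks H u v.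

Lemma all_trackW H H' z z' : H <= H' -> all_track H z z' -> all_track H' z z'.
Proof. by move=> HH h u v zu zv; exact: tracksW HH (h _ _ zu zv). Qed.

Lemma all_trackC H z z' : all_track H z z' -> all_track H z' z.
Proof. by move=> h u v /btwC zu /btwC zv; exact: h. Qed.

(** Points of [[u, v]] are [4 D]-close to [[u', w]] or [[w, v']]. At a switch [x], both [[u, x]] and
    [[x, v]] are perturbations of tracked intervals, and thinness joins them in [X] at [iota x]. *)
Lemma all_track_cat_mid H z w z' u v u' v' :
  all_track H z w -> all_track H w z' -> dist u u' <= D -> dist v v' <= D ->
  btw z u' w -> btw w v' z' -> tracks (H + 13 * D + 2) u v.
Proof.
move=> tr1 tr2 uu vv zu wv; have D0 := thin_ge0 thY z.
pose P x := exists2 c, btw u' c w & dist x c <= 4 * D.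
pose Q x := exists2 c, btw w c v' & dist x c <= 4 * D.
have [||x /(perturb_interval thY (r := D)) xx|x [y [uxv uyv [c1 uc1 xc1] [c2 vc2 yc2] xy]]] :=
    @interval_connected _ _ P Q u v gY.
- by exists u'; [exact: btw_l|lra].
- by exists v'; [exact: btw_r|lra].
- have [||x' x'u xx'] := xx u' v'; [by rewrite dist_sym|by rewrite dist_sym|].
  have [x2 h xx2] := thY w x'u; have := dist_triangle x x' x2 => h2.
  by case: h => h; [left|right]; exists x2 => //; lra.
have t1 : tracks (H + 4 * D + 2 * (4 * D + 1)) u x.
  apply: (perturb_tracks (u := u') (v := c1)); rewrite 1?dist_sym; [lra|lra|].
  by apply: tr1 => //; apply/btwC/(btw_trans (btwC zu))/btwC.
have t2 : tracks (H + 4 * D + 2 * (4 * D + 1)) x v.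
  apply: (perturb_tracks (u := c2) (v := v')); rewrite 1?dist_sym; [|lra|].
    by have := dist_triangle x y c2; lra.
  by apply: tr2 => //; exact: btw_trans wv _.
move=> p /(thX (iota x))[p' [/t1|/t2] [q uq p'q] pp'];
  exists q; try by have := dist_triangle p p' (iota q); lra.
  exact: btw_trans uxv _.
exact/btwC/(btw_trans (btwC uxv))/btwC.
Qed.

Lemma all_track_cat H z w z' : all_track H z w -> all_track H w z' ->
  all_track (H + 13 * D + 2) z z'.
Proof.
move=> tr1 tr2 u v zu zv; have D0 := thin_ge0 thY z.
have [u' hu uu] := thY w zu; have [v' hv vv] := thY w zv.
have same : tracks H u' v' -> tracks (H + 13 * D + 2) u v.
  move=> h; apply: tracksW (perturb_tracks (r := D) (u' := u) (v' := v) _ _ h).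
  - lra.
  - by rewrite dist_sym.
  - by rewrite dist_sym.
case: hu => hu; case: hv => hv.
- by apply: same; exact: tr1.
- exact: all_track_cat_mid tr1 tr2 uu vv hu hv.
- exact: all_track_cat_mid (all_trackC tr2) (all_trackC tr1) uu vv (btwC hu) (btwC hv).
- by apply: same; exact: tr2.
Qed.

Lemma all_track_short r z z' : dist z z' <= r -> all_track (2 * r) z z'.
Proof.
move=> zz u v zu zv p up; exists u; first exact: btw_l.
have h1 := btw_le up; have h2 := iota_lip u v; have h3 := btw_le zu.
have h4 := btw_le zv; have h5 := dist_triangle u z v.
by rewrite (dist_sym p); rewrite (dist_sym u z) in h5; lra.
Qed.

(** Some [p] in the interval of [X] is close to the images of a [q] in [[z, c]] and a [q'] in
    [[c, z']]. Properness makes [q] and [q'] close in [Y], and [c] lies between them. *)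
Lemma tracks_converse H : exists H', forall z z' c, all_track H z z' ->
  btw z c z' -> exists2 p, btw (iota z) p (iota z') & dist p (iota c) <= H'.
Proof.
have [r hr] := iota_proper (2 * (D + H) + 1); exists (D + H + r) => z z' c tr zc.
pose P p := exists2 q, btw z q c & dist p (iota q) <= D + H.
pose Q p := exists2 q, btw c q z' & dist p (iota q) <= D + H.
have D0 := thin_ge0 thY z; have H0 : 0 <= H.
  have [q _] := tr _ _ (btw_l z z') (btw_l z z') _ (btw_l (iota z) (iota z)).
  by apply: le_trans; exact: dist_ge0.
have [||p /(thX (iota c))[p' h pp']|p [p' [zp _ [q zq pq] [q' q'z pq'] pp]]] :=
    @interval_connected _ _ P Q (iota z) (iota z') gX.
- by exists z; [exact: btw_l|rewrite distxx; lra].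
- by exists z'; [exact: btw_r|rewrite distxx; lra].
- have tri q := dist_triangle p p' (iota q).
  case: h => [/(tr _ _ (btw_l z z') zc)|/(tr _ _ zc (btw_r z z'))] [q zq p'q];
    by [left; exists q => //; have := tri q; lra|right; exists q => //; have := tri q; lra].
exists p => //; have qcq := btw_mid zc zq q'z.
have qq : dist q q' <= r.
  apply: hr; have := dist_triangle (iota q) p (iota q').
  by have := dist_triangle p p' (iota q'); rewrite (dist_sym (iota q) p); lra.
by have := btw_le qcq; have := iota_lip q c; have := dist_triangle p (iota q) (iota c); lra.
Qed.

Section Cones.
Context {J : Type} (A : J -> set Y).
Hypothesis K0 : 0 <= K.
Hypothesis qcAY : forall j, interval_quasiconvex K (A j).
Hypothesis qcAX : forall j, interval_quasiconvex K (iota @` A j).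
Local Notation base := (cone_base A).

Lemma quasiconvex_all_track : exists H, forall j z z',
  A j z -> A j z' -> all_track H z z'.
Proof.
have [H hH] := quasiconvex_tracks K0; exists (H + 4 * D + 2 * K).
move=> j z z' Az Az' u v /(qcAY Az Az')[u' Au' uu'] /(qcAY Az Az')[v' Av' vv'].
apply: (perturb_tracks (u := u') (v := v')); [by rewrite dist_sym..|].
exact: (hH _ (@qcAX j)).
Qed.

(** Induction on the jumps of a route: [all_track_cat] joins a short interval, an interval with ends
    in [A j] and the rest of the route. *)
Lemma electric_all_track (C : R) : exists H, forall z z',
  dist (base z) (base z') <= C -> all_track H z z'.
Proof.
have [HA hA] := quasiconvex_all_track.
pose N := (Num.truncn (C + 1)).+1.
suff [H hH] : exists H, forall n l z z', (n <= N)%N -> l <= C + 1 ->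
    route A n l z z' -> all_track H z z'.
  exists H => z z' /route_bounded[n [l [rt nN /andP[_ lC]]]].
  exact: hH nN lC rt.
elim: N => [|N [H hH]].
  exists (2 * (C + 1)) => n l z z'; rewrite leqn0 => /eqP -> lC /= h.
  by apply: all_track_short; exact: le_trans lC.
pose M := Num.max (Num.max HA H) (2 * (C + 1)).
have HAM : HA <= M by rewrite !le_max lexx.
have HM : H <= M by rewrite !le_max lexx !orbT.
have CM : 2 * (C + 1) <= M by rewrite !le_max lexx !orbT.
exists (M + 13 * D + 2 + 13 * D + 2) => n l z z' nN lC; have D0 := thin_ge0 thY z.
case: n nN => [|n] nN /=.
  move=> h; apply: (@all_trackW (2 * (C + 1))); first lra.
  by apply: all_track_short; exact: le_trans lC.
move=> [j [a [b [Aa Ab rt]]]]; have l0 := route_ge0 rt; have za := dist_ge0 z a.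
apply: (all_track_cat (w := b)).
  apply: (all_track_cat (w := a)).
    by apply: (all_trackW CM); apply: all_track_short; lra.
  exact: all_trackW HAM (hA _ _ _ Aa Ab).
by apply: (@all_trackW H); [lra|apply: hH rt; [by []|lra]].
Qed.

End Cones.
End Embedding.

(** * Gromov boundaries and Cannon-Thurston maps *)

Section Sequences.
Context {R : realType} {T : metricType R}.
Implicit Types (p q x y : T) (u v w : nat -> T).

Lemma gromov_productC p x y : gromov_product p x y = gromov_product p y x.
Proof. by rewrite !gromovE (dist_sym x y) (addrC (dist x p)). Qed.

Lemma gromov_product_basepoint p q x y :
  gromov_product p x y <= gromov_product q x y + dist p q.
Proof.
rewrite !gromovE; have := dist_triangle x q p; have := dist_triangle y q p.
by rewrite (dist_sym q p); lra.
Qed.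

Lemma gromov_product_move p x y x' :
  gromov_product p x y <= gromov_product p x' y + dist x x'.
Proof.
rewrite !gromovE; have := dist_triangle x x' p; have := dist_triangle x' x y.
by rewrite (dist_sym x' x); lra.
Qed.

Definition diverge p u v := forall r, exists N, forall m n,
  (N <= m)%N -> (N <= n)%N -> r <= gromov_product p (u m) (v n).

Lemma boundary_equivP p u v : boundary_equiv u v <-> diverge p u v.
Proof.
split => [h r|h q].
  have /cvgryPge/(_ r)[[P Q] /= [[N1 _ h1] [N2 _ h2]] hPQ] := h p.
  exists (maxn N1 N2) => m n; rewrite !geq_max => /andP[? ?] /andP[? ?].
  by apply: (hPQ (m, n)); split; [exact: h1|exact: h2].
apply/cvgryPge => r; have [N hN] := h (r + dist p q).
exists ([set n | (N <= n)%N], [set n | (N <= n)%N]).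
  by split; exists N.
move=> [m n] /= [Nm Nn]; have := hN _ _ Nm Nn.
by have := gromov_product_basepoint p q (u m) (v n); lra.
Qed.

Lemma divergeC p u v : diverge p u v -> diverge p v u.
Proof.
by move=> h r; have [N hN] := h r; exists N => m n Nm Nn; rewrite gromov_productC hN.
Qed.

Lemma not_diverge p u v : ~ diverge p u v -> exists C, forall N, exists m n,
  [/\ (N <= m)%N, (N <= n)%N & gromov_product p (u m) (v n) <= C].
Proof.
move=> /existsNP[C hC]; exists C => N; apply: contrapT => h.
apply: hC; exists N => m n Nm Nn; rewrite leNgt; apply/negP => lt.
by apply: h; exists m, n; split => //; exact: ltW.
Qed.

Context {D : R}.
Hypotheses (gT : geod T) (thT : thin D T).

Lemma diverge_trans p u v w : diverge p u v -> diverge p v w -> diverge p u w.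
Proof.
move=> h1 h2 r; have [N1 h1'] := h1 (r + 3 * D + 1); have [N2 h2'] := h2 (r + 3 * D + 1).
pose k := maxn N1 N2; have [k1 k2] : (N1 <= k)%N /\ (N2 <= k)%N by rewrite !leq_max !leqnn orbT.
exists k => m n km kn; have := gromov_product_4pt gT thT p (u m) (v k) (w n).
have := h1' _ _ (leq_trans k1 km) k1; have := h2' _ _ k2 (leq_trans k2 kn).
by rewrite minEle; case: ifP => _; lra.
Qed.

Lemma boundary_equivC u v : boundary_equiv u v -> boundary_equiv v u.
Proof. by move/(boundary_equivP (u 0%N))/divergeC/boundary_equivP. Qed.

Lemma boundary_equiv_trans u v w :
  boundary_equiv u v -> boundary_equiv v w -> boundary_equiv u w.
Proof.
move=> /(boundary_equivP (u 0%N)) h1 /(boundary_equivP (u 0%N)) h2.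
exact/boundary_equivP/diverge_trans/h2.
Qed.

Lemma boundary_equiv_to_infinity u v : boundary_equiv u v -> to_infinity v.
Proof. by move=> h; exact: boundary_equiv_trans (boundary_equivC h) h. Qed.

Lemma tends_toP (xi : boundary T) : exists2 w, to_infinity w &
  forall v, tends_to v xi <-> to_infinity v /\ boundary_equiv w v.
Proof.
have [w hw e] := boundary_classP xi; exists w => // v.
by rewrite /tends_to e.
Qed.

Lemma boundary_rep (xi : boundary T) : exists u, tends_to u xi.
Proof. by have [w hw h] := tends_toP xi; exists w; apply/h. Qed.

Lemma tends_to_infinity u (xi : boundary T) : tends_to u xi -> to_infinity u.
Proof. by have [w hw h] := tends_toP xi; case/h. Qed.

Lemma tends_to_equiv u v (xi : boundary T) :
  tends_to u xi -> tends_to v xi -> boundary_equiv u v.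
Proof.
have [w hw h] := tends_toP xi => /h[_ /boundary_equivC wu] /h[_ wv].
exact: boundary_equiv_trans wu wv.
Qed.

Lemma equiv_tends_to u v (xi : boundary T) :
  tends_to u xi -> boundary_equiv u v -> tends_to v xi.
Proof.
have [w hw h] := tends_toP xi => /h[hu wu] uv; apply/h; split.
  exact: boundary_equiv_to_infinity uv.
exact: boundary_equiv_trans wu uv.
Qed.

Lemma to_infinity_tends u : to_infinity u -> exists xi : boundary T, tends_to u xi.
Proof.
move=> hu; have h : exists2 w, to_infinity w &
    [set v | to_infinity v /\ boundary_equiv u v] =
    [set v | to_infinity v /\ boundary_equiv w v] by exists u.
by exists (Boundary h); split.
Qed.

Lemma tends_to_inj u v (xi eta : boundary T) : tends_to u xi -> tends_to v eta ->
  boundary_equiv u v -> xi = eta.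
Proof.
move=> uxi veta uv; have e : boundary_class xi = boundary_class eta.
  apply/seteqP; split => w h.
    apply: (equiv_tends_to veta); apply: boundary_equiv_trans (boundary_equivC uv) _.
    exact: tends_to_equiv uxi h.
  by apply: (equiv_tends_to uxi); apply: boundary_equiv_trans uv (tends_to_equiv veta h).
case: xi e {uxi} => C hC; case: eta {veta} => C' hC' /= e.
by subst C'; rewrite (Prop_irrelevance hC hC').
Qed.

End Sequences.

Section CannonThurston.
Context {R : realType} {X Y : metricType R} (f : Y -> X) {DX DY : R}.
Hypotheses (gX : geod X) (thX : thin DX X) (gY : geod Y) (thY : thin DY Y).

(** Mitra's criterion for intervals, with the radius [r] in the target given first instead of a
    function [M]. *)
Definition far_proper := forall (y0 : Y) (r : R), exists N : R, forall y y',
  far N y0 y y' -> far r (f y0) (f y) (f y').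

Hypothesis fp : far_proper.

Lemma gromov_proper (y0 : Y) (r : R) : exists s : R, forall y y',
  s <= gromov_product y0 y y' -> r <= gromov_product (f y0) (f y) (f y').
Proof.
have [N hN] := fp y0 (r + 2 * DX + 1); exists N => y y' /le_gromov_product_far/hN.
exact: far_gromov_product.
Qed.

Lemma diverge_map (y0 : Y) (u v : nat -> Y) :
  diverge y0 u v -> diverge (f y0) (f \o u) (f \o v).
Proof.
move=> h r; have [s hs] := gromov_proper y0 r; have [N hN] := h s.
by exists N => m n Nm Nn; apply: hs; exact: hN.
Qed.

Lemma boundary_equiv_map (u v : nat -> Y) :
  boundary_equiv u v -> boundary_equiv (f \o u) (f \o v).
Proof. by move/(boundary_equivP (u 0%N))/diverge_map/boundary_equivP. Qed.

Lemma far_proper_CT : admits_CT_map f.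
Proof.
have [|df hdf] := @choice _ _ (fun (xi : boundary Y) (eta : boundary X) =>
    forall u, tends_to u xi -> tends_to (f \o u) eta).
  move=> xi; have [u uxi] := boundary_rep xi.
  have [eta feta] := to_infinity_tends (boundary_equiv_map (tends_to_infinity uxi)).
  exists eta => v vxi; apply: (equiv_tends_to gX thX feta).
  exact/boundary_equiv_map/(tends_to_equiv gY thY uxi vxi).
exists df; split; first by move=> u xi; exact: hdf.
apply/continuousP => O Oopen; suff : boundary_open (df @^-1` O) by [].
have {}Oopen : boundary_open O := Oopen.
move=> xi Oxi p.
have [r hr] := Oopen _ Oxi (f p); have [s hs] := gromov_proper p r.
(* One more than [s], so that the supremum in [liminf2] exceeds [s] strictly and the products of
   some tail are at least [s]. *)
exists (s + 1) => eta [u [v [uxi veta]]] hl; apply: hr.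
exists (f \o u), (f \o v); split; [exact: hdf|exact: hdf|].
have /ereal_sup_gt[_ [N _ <-] hN] :
    (s%:E < liminf2 (fun i j => gromov_product p (u i) (v j)))%E.
  by apply: lt_le_trans hl; rewrite lte_fin; lra.
apply: ereal_sup_ge; exists (ereal_inf [set (gromov_product (f p) (f (u mn.1)) (f (v mn.2)))%:E |
  mn in [set mn | (N <= mn.1)%N /\ (N <= mn.2)%N]]); first by exists N.
apply/ereal_infP => _ [mn hmn <-]; rewrite lee_fin; apply: hs.
rewrite -lee_fin; apply: le_trans (ltW hN) _.
by apply: ereal_inf_lbound; exists mn.
Qed.

End CannonThurston.

Lemma mitra_far_proper (R : realType) (X Y : metricType R) (f : Y -> X) :
  geodesic_space X -> geodesic_space Y -> mitra_criterion f -> far_proper f.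
Proof.
move=> gX gY mf y0 r; have [M [_ Moo hM]] := mf y0.
have [N N0 MN] : exists2 N, 0 <= N & r <= M N.
  (* Numbers strictly above [A] are admissible, and the criterion asks for [N >= 0]. *)
  move/cvgryPge: Moo => /(_ r)[A [_ hA]]; exists (Num.max A 0 + 1).
    by have : 0 <= Num.max A 0; [rewrite le_max lexx orbT|lra].
  by apply: hA; have : A <= Num.max A 0; [rewrite le_max lexx|lra].
exists N => y y' fy q fq; have [S hS Sq] := btw_in_segment gX fq.
have [L hL] := gY y y'.
have : L `&` ball y0 N = set0.
  apply/seteqP; split => // z [Lz]; rewrite ballEmdist /= ltNge => /negP; apply.
  exact/fy/(segment_btw hL).
move=> /(hM _ N0 _ _ _ hL)/(_ _ hS) dis; apply: le_trans MN _.
rewrite leNgt; apply/negP => h.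
suff : (S `&` ball (f y0) (M N)) q by rewrite dis.
by split => //; rewrite ballEmdist.
Qed.

(** * Boundaries of coned-off spaces *)

Section ElectricBoundary.
Context {R : realType} {T : metricType R} {I : Type} {B : I -> set T}.
Local Notation base := (cone_base B).
Variables (D Dh K : R).
Hypotheses (gT : geod T) (thT : thin D T) (K0 : 0 <= K).
Hypothesis qcB : forall i, interval_quasiconvex K (B i).
Hypotheses (gTh : geodesic_space (coned_off B)) (thTh : thin Dh (coned_off B)).
Implicit Types (p q x y : T) (u v : nat -> T).

Lemma electric_far : exists H : R, forall N p x y,
  far (N + H) (base p) (base x) (base y) ->
  forall q, btw x q y -> N <= dist (base p) (base q).
Proof.
have [H hH] := electric_geodesics gT thT K0 qcB gTh.
exists H => N p x y h q xqy; have [r /h pr qr] := (hH x y).1 _ xqy.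
by have := dist_triangle (base p) (base q) r; lra.
Qed.

Lemma electric_near : exists H : R, forall C p x y,
  gromov_product (base p) (base x) (base y) <= C ->
  exists2 q, btw x q y & dist (base p) (base q) <= C + H.
Proof.
have [H hH] := electric_geodesics gT thT K0 qcB gTh.
exists (2 * Dh + 1 + H) => C p x y h.
have [r xry pr] := gromov_product_near (geodesic_geod gTh) thTh (base p) (base x) (base y).
have [q xqy qr] := (hH x y).2 _ xry; exists q => //.
have := dist_triangle (base p) r (base q); rewrite (dist_sym r); lra.
Qed.

(** Intervals far from [p] for the coned-off metric are far from it in [T], since [base] is
    1-Lipschitz. *)
Lemma electric_diverge p u v :
  diverge (base p) (base \o u) (base \o v) -> diverge p u v.
Proof.
have [H hH] := electric_far => h r; have [N hN] := h (r + 2 * D + 1 + H).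
exists N => m n Nm Nn; apply: (far_gromov_product gT thT) => q xqy.
apply: le_trans (cone_base_lip B p q).
by apply: hH xqy; apply: le_gromov_product_far; exact: hN.
Qed.

(* If [u m, v n] passed near p in the coned-off space, at a point q far from p
   in T, then all of [p, q] would be near p in the coned-off space; a long
   initial part of it follows [p, u m], hence [p, u N], which is short. *)
Lemma electric_diverge_converse p u v :
  diverge (base p) (base \o u) (base \o u) -> diverge p u v ->
  diverge (base p) (base \o u) (base \o v).
Proof.
move=> uu uv; apply: contrapT => /not_diverge[C hC].
have [H1 hfar] := electric_far; have [H2 hnear] := electric_near.
have [S hS] := electric_narrow thT K0 qcB (C + H2).
have D0 := thin_ge0 thT p.
(* [z] will be the point at distance [r] on [[p, q]]. By the choice of [N], [[u N, u m]] is too far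
   in the coned-off space to come near [z]; [[p, u N]] is too short for that, and [N'] keeps
   [[u m, q]] away. *)
have [N hN] := uu (S + 2 * D + 1 + H1).
pose r := dist p (u N) + 2 * D + 1.
have r0 : 0 <= r by rewrite /r; have := dist_ge0 p (u N); lra.
have [N' hN'] := uv (r + D + 1).
have [m [n [Nm Nn /hnear[q uqv pq]]]] := hC (maxn N N').
move: Nm Nn; rewrite !geq_max => /andP[Nm N'm] /andP[Nn N'n].
have far_uv : far (r + D + 1) p (u m) (v n).
  by apply: le_gromov_product_far; exact: hN'.
have [|z pzq pz] := gT (x := p) (y := q) (r := r).
  by have := far_uv _ uqv; lra.
have zS := hS _ _ _ pq pzq.
have [z1 [pz1|/btwC umq] zz1] := thT (u m) pzq; last first.
  have := far_uv _ (btw_trans uqv (btwC umq)).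
  by have := dist_triangle p z z1; lra.
have [z2 [pz2|z2u] z1z2] := thT (u N) pz1.
  have := btw_le pz2; have := dist_triangle p z2 z; have := dist_triangle z2 z1 z.
  by rewrite (dist_sym z2 z1) (dist_sym z1 z); rewrite /r in pz *; lra.
have : S + 2 * D + 1 <= dist (base p) (base z2).
  by apply: hfar z2u; apply: le_gromov_product_far; exact: hN.
have := dist_triangle (base p) (base z) (base z2).
have := cone_base_lip B z z2; have := dist_triangle z z1 z2.
lra.
Qed.

(** If [u] does not diverge in the coned-off space, there are intervals [[u m, u n]] with [m] and
    [n] arbitrarily large that meet a fixed coned-off ball around [p]. The points [q k] found there
    lie on these intervals, hence have the same limit as [u]. *)
Lemma electric_bounded_or p u : diverge p u u ->
  diverge (base p) (base \o u) (base \o u) \/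
  exists (C : R) (q : nat -> T), diverge p u q /\ forall k : nat, dist (base p) (base (q k)) <= C.
Proof.
move=> uu; have [H hH] := electric_near.
case: (pselect (diverge (base p) (base \o u) (base \o u))) => [|/not_diverge[C hC]].
  by left.
right; exists (C + H).
have [|q hq] := @choice _ _ (fun (k : nat) q => exists m n, [/\ (k <= m)%N, (k <= n)%N,
    btw (u m) q (u n) & dist (base p) (base q) <= C + H]).
  by move=> k; have [m [n [km kn /hH[q ? ?]]]] := hC k; exists q, m, n.
exists q; split => [|k]; last by have [m [n [_ _ _]]] := hq k.
(* [2 D + 1] is spent in [far_gromov_product] and [3 D + 1] in the four point inequality. *)
move=> r; have [N hN] := uu (r + 5 * D + 2); exists N => m k Nm Nk.
have [i [j [ki kj iqj _]]] := hq k.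
have [Ni Nj] := (leq_trans Nk ki, leq_trans Nk kj).
have h1 := hN _ _ Nm Ni.
have h2 : r + 3 * D + 1 <= gromov_product p (u i) (q k).
  apply: (far_gromov_product gT thT) => w iwq.
  have := le_gromov_product_far (hN _ _ Ni Nj) (btw_trans iqj iwq); lra.
have D0 := thin_ge0 thT p.
have := gromov_product_4pt gT thT p (u m) (u i) (q k).
by rewrite minEle; case: ifP => _; lra.
Qed.

(** Instead of a first point in the ball, take one whose distance from [y], rounded up, is minimal,
    and go back by 2, or to [y] if that is nearer. *)
Lemma first_electric_point (C : R) y0 y y' :
  (exists2 z, btw y z y' & dist (base y0) (base z) <= C) ->
  exists z, [/\ btw y z y', dist (base y0) (base z) <= C + 2 &
    z = y \/ forall w, btw y w z -> C < dist (base y0) (base w)].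
Proof.
move=> [z0 yz0 hz0].
pose P (k : nat) := exists z, [/\ btw y z y', dist (base y0) (base z) <= C & dist y z <= k%:R].
have exP : exists k, `[< P k >].
  exists (Num.truncn (dist y z0)).+1; apply/asboolP; exists z0; split => //.
  exact/ltW/truncnS_gt.
case: (ex_minnP exP) => k /asboolP[z [yzy' hz yzk]] kmin.
have early w : btw y w y' -> dist (base y0) (base w) <= C -> k%:R - 1 < dist y w.
  move=> yw hw; rewrite ltNge; apply/negP => wk.
  case: k {yzk} kmin wk => [|k] kmin wk; first by have := dist_ge0 y w; lra.
  rewrite -natr1 addrK in wk; have : (k.+1 <= k)%N by apply/kmin/asboolP; exists w.
  by rewrite ltnn.
case: (leP (dist y z) 2) => h2.
  exists y; split; [exact: btw_l| |by left].
  have := dist_triangle (base y0) (base z) (base y); have := cone_base_lip B z y.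
  by rewrite (dist_sym z y); lra.
have [|z2 yz2 dz2] := gT (x := y) (y := z) (r := dist y z - 2); first by lra.
have yz2y' := btw_trans yzy' yz2; exists z2; split => //.
  have := dist_triangle (base y0) (base z) (base z2); have := cone_base_lip B z z2.
  by move: yz2; rewrite /btw (dist_sym z z2); lra.
right => w yw; rewrite ltNge; apply/negP => hw.
have := early _ (btw_trans yz2y' yw) hw; have := btw_le yw; lra.
Qed.

End ElectricBoundary.

(** * Cannon-Thurston maps of the embedding and of the coned-off spaces *)

Section Main.
Context {R : realType} {X Y : metricType R} {iota : Y -> X} {D K Dh : R}.
Context {I J : Type} {B : I -> set X} {A : J -> set Y} {phi : J -> I}.
Variable subAB : forall j, iota @` A j `<=` B (phi j).
Hypotheses (geoX : geodesic_space X) (geoY : geodesic_space Y).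
Hypotheses (thX : thin D X) (thY : thin D Y).
Hypothesis iota_lip : forall y y', dist (iota y) (iota y') <= dist y y'.
Hypothesis iota_proper : forall M : R, exists r : R, forall y y',
  dist (iota y) (iota y') <= M -> dist y y' <= r.
Hypothesis K0 : 0 <= K.
Hypothesis qcB : forall i, interval_quasiconvex K (B i).
Hypothesis qcAY : forall j, interval_quasiconvex K (A j).
Hypothesis qcAX : forall j, interval_quasiconvex K (iota @` A j).
Hypotheses (geoXh : geodesic_space (coned_off B)) (geoYh : geodesic_space (coned_off A)).
Hypotheses (thXh : thin Dh (coned_off B)) (thYh : thin Dh (coned_off A)).
Hypothesis far_hat : far_proper (coned_map subAB).
Local Notation baseX := (cone_base B).
Local Notation baseY := (cone_base A).
Let gX := geodesic_geod geoX.
Let gY := geodesic_geod geoY.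

Lemma coned_map_lip y y' :
  dist (baseX (iota y)) (baseX (iota y')) <= dist (baseY y) (baseY y').
Proof.
have chain p q a : cone_chain p q a -> dist (coned_map subAB p) (coned_map subAB q) <= a.
  elim=> {p q a} [p|p q r a b st _ ih]; first by rewrite distxx.
  apply: le_trans (dist_triangle _ (coned_map subAB q) _) _; apply: lerD ih.
  case: st => [z z'|j z {}p {}q s t ps qt].
    exact: le_trans (cone_base_lip _ _ _) (iota_lip _ _).
  have edge p' s' : on_edge j z p' s' -> on_edge (phi j) (iota z) (coned_map subAB p') s'.
    by case=> [Az|Az s0 s01|A0 Az] /=; constructor; apply: subAB; exists z.
  exact: cone_step_dist (cone_step_edge (edge _ _ ps) (edge _ _ qt)).
rewrite leNgt; apply/negP => /cone_dist_chain[b /chain /= h]; rewrite ltNge => /negP.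
by apply.
Qed.

(** [z] and [z'] are nearly the first points of [[y, y']], from either end, in a coned-off ball of
    radius [C]. Mitra's criterion handles [[y, z]] and [[z', y']], which avoid this ball or are
    trivial. Between [z] and [z'] the intervals of [X] track those of [Y], whose images are far by
    properness. *)
Lemma iota_far_proper : far_proper iota.
Proof.
move=> y0 r; have D0 := thin_ge0 thY y0.
have [HX farX] := electric_far gX thX K0 qcB geoXh.
have [HY geoHY] := electric_geodesics gY thY K0 qcAY geoYh.
(* The [2 D] pay for the final quadrilateral in [X]. *)
pose r1 := r + 2 * D.
have [N1 hN1] := far_hat (baseY y0) (r1 + HX).
pose C := N1 + HY.
have out y z : (forall u, btw y u z -> C <= dist (baseY y0) (baseY u)) ->
    far r1 (iota y0) (iota y) (iota z).
  move=> h; have hY : far N1 (baseY y0) (baseY y) (baseY z).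
    move=> q /(geoHY y z).2[u /h hu uq]; rewrite /C in hu.
    have := dist_triangle (baseY y0) q (baseY u); rewrite (dist_sym q); lra.
  move=> p yp; apply: le_trans (cone_base_lip B _ _).
  exact: farX (hN1 _ _ hY) _ yp.
have [H hH] := electric_all_track geoX gY thX thY iota_lip iota_proper K0 qcAY qcAX (2 * (C + 2)).
have [rho hrho] := iota_proper (Num.max r1 (r1 + H)).
exists (rho + D + 1) => y y' fy.
have [close|/forall2NP nclose] :=
  pselect (exists2 z, btw y z y' & dist (baseY y0) (baseY z) <= C); last first.
  apply: (@farW _ _ _ r1); first by rewrite /r1; lra.
  apply: out => u yu; rewrite leNgt; apply/negP => lt.
  by case: (nclose u) => //; apply; exact: ltW.
have [z [yz y0z hz]] := first_electric_point gY close.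
have close' : exists2 w, btw y' w y & dist (baseY y0) (baseY w) <= C.
  by have [w yw ?] := close; exists w => //; exact: btwC.
have [z' [/btwC yz' y0z' hz']] := first_electric_point gY close'.
have farX0 q : btw y q y' -> Num.max r1 (r1 + H) < dist (iota y0) (iota q).
  move=> yq; rewrite ltNge; apply/negP => /hrho; have := fy _ yq; lra.
have end_far x w : btw y x y' ->
    w = x \/ (forall u, btw x u w -> C < dist (baseY y0) (baseY u)) ->
    far r1 (iota y0) (iota x) (iota w).
  move=> yx [->|h]; last by apply: out => u /h/ltW.
  move=> q /btw_xx ->; apply: le_trans (ltW (farX0 _ yx)).
  by rewrite le_max lexx.
have tr : all_track (iota := iota) H z z'.
  apply: hH; have := dist_triangle (baseY z) (baseY y0) (baseY z').
  by rewrite (dist_sym (baseY z) (baseY y0)); lra.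
have mid : far r1 (iota y0) (iota z) (iota z').
  move=> p /(tr _ _ (btw_l _ _) (btw_r _ _))[q zq pq].
  (* [z] and [z'] may lie on different geodesics from [y] to [y']; thinness with apex [y] leads from
     [q] back to [[y, y']]. *)
  have [q2 hq2 qq2] := thY y zq.
  have yq2 : btw y q2 y'.
    by case: hq2 => h; [exact: btw_trans yz (btwC h)|exact: btw_trans yz' h].
  rewrite leNgt; apply/negP => lt.
  have : dist y0 q <= rho.
    apply: hrho; apply: (@le_trans _ _ (r1 + H)); last by rewrite le_max lexx orbT.
    by have := dist_triangle (iota y0) p (iota q); lra.
  have := fy _ yq2; have := dist_triangle y0 q q2; lra.
move=> p /(thin2 thX (iota z) (iota z'))[q hq pq].
suff : r1 <= dist (iota y0) q by have := dist_triangle (iota y0) p q; rewrite /r1; lra.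
case: hq => [/(end_far _ _ (btw_l _ _) hz)//|/mid//|/btwC].
exact: (end_far _ _ (btw_r _ _) hz').
Qed.

(** By [tracks_converse], points of [[u m, v n]] are close to the interval of [X] between the
    images. *)
Lemma bounded_reflect (y0 : Y) (C : R) (u v : nat -> Y) :
  (forall k, dist (baseY y0) (baseY (u k)) <= C) ->
  (forall k, dist (baseY y0) (baseY (v k)) <= C) ->
  diverge (iota y0) (iota \o u) (iota \o v) -> diverge y0 u v.
Proof.
move=> uC vC uv.
have [H hH] := electric_all_track geoX gY thX thY iota_lip iota_proper K0 qcAY qcAX (2 * C).
have [H' hH'] := tracks_converse geoX thX thY iota_lip iota_proper H.
move=> r; have [N hN] := uv (r + 2 * D + 1 + H'); exists N => m n Nm Nn.
apply: (far_gromov_product gY thY) => c ucv.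
have tr : all_track (iota := iota) H (u m) (v n).
  apply: hH; have := dist_triangle (baseY (u m)) (baseY y0) (baseY (v n)).
  by have := uC m; have := vC n; rewrite (dist_sym (baseY (u m)) (baseY y0)); lra.
have [p upv pc] := hH' _ _ _ tr ucv.
have := le_gromov_product_far (hN _ _ Nm Nn) upv; have := iota_lip y0 c.
have := dist_triangle (iota y0) (iota c) p; rewrite (dist_sym (iota c) p).
lra.
Qed.

(** Otherwise [electric_diverge_converse] would give equivalence in the coned-off [X], where Gromov
    products with a bounded sequence are bounded. *)
Lemma mixed_not_equiv (y0 : Y) (C : R) (u v : nat -> Y) :
  diverge (baseY y0) (baseY \o u) (baseY \o u) ->
  (forall k, dist (baseY y0) (baseY (v k)) <= C) ->
  ~ diverge (iota y0) (iota \o u) (iota \o v).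
Proof.
move=> uu vC uv.
have uuX := diverge_map (geodesic_geod geoXh) thXh far_hat uu.
have [N hN] := electric_diverge_converse gX thX K0 qcB geoXh thXh uuX uv (C + 1).
have := hN N N (leqnn _) (leqnn _); rewrite gromovE /=.
have := dist_triangle (baseX (iota (u N))) (baseX (iota (v N))) (baseX (iota y0)).
have := coned_map_lip y0 (v N); have := vC N.
by rewrite (dist_sym (baseX (iota (v N)))); lra.
Qed.

Variables (diota : boundary Y -> boundary X)
  (diotah : boundary (coned_off A) -> boundary (coned_off B)).
Hypotheses (ct : is_CT_map iota diota) (cth : is_CT_map (coned_map subAB) diotah).
Let gXh := geodesic_geod geoXh.
Let gYh := geodesic_geod geoYh.

(** By [electric_bounded_or], each of [u] and [v] diverges in the coned-off [Y] or shares its limit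
    with a sequence bounded there. If both diverge, injectivity of [diotah] applies;
    [mixed_not_equiv] excludes the mixed cases, and [bounded_reflect] settles the last. *)
Lemma inj_reflect (y0 : Y) (u v : nat -> Y) : injective diotah ->
  diverge y0 u u -> diverge y0 v v ->
  diverge (iota y0) (iota \o u) (iota \o v) -> diverge y0 u v.
Proof.
move=> inj uu vv uv.
have map_iota := diverge_map gX thX iota_far_proper.
have [uh|[C [q [uq qC]]]] := electric_bounded_or gY thY K0 qcAY geoYh thYh uu;
  have [vh|[C' [q' [vq q'C]]]] := electric_bounded_or gY thY K0 qcAY geoYh thYh vv.
- have [xi uxi] := to_infinity_tends (proj2 (boundary_equivP _ _ _) uh).
  have [eta veta] := to_infinity_tends (proj2 (boundary_equivP _ _ _) vh).
  have xieta : xi = eta.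
    apply: inj; apply: (tends_to_inj gXh thXh (cth.1 _ _ uxi) (cth.1 _ _ veta)).
    apply/boundary_equivP; apply: (electric_diverge_converse gX thX K0 qcB geoXh thXh _ uv).
    exact: (diverge_map gXh thXh far_hat uh).
  apply: (electric_diverge gY thY K0 qcAY geoYh).
  apply/boundary_equivP/(tends_to_equiv gYh thYh uxi); rewrite xieta; exact: veta.
- exfalso; apply: (mixed_not_equiv uh q'C).
  exact (diverge_trans gX thX uv (map_iota _ _ _ vq)).
- exfalso; apply: (mixed_not_equiv vh qC).
  exact (diverge_trans gX thX (divergeC uv) (map_iota _ _ _ uq)).
have qq' : diverge y0 q q'.
  apply: (bounded_reflect (C := Num.max C C')).
  - by move=> k; apply: le_trans (qC k) _; rewrite le_max lexx.
  - by move=> k; apply: le_trans (q'C k) _; rewrite le_max lexx orbT.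
  apply: (diverge_trans gX thX (divergeC (map_iota _ _ _ uq))).
  exact (diverge_trans gX thX uv (map_iota _ _ _ vq)).
exact (diverge_trans gY thY (diverge_trans gY thY uq qq') (divergeC vq)).
Qed.

Lemma injective_of_hat : injective diotah -> injective diota.
Proof.
move=> inj xi eta e; have [u uxi] := boundary_rep xi; have [v veta] := boundary_rep eta.
apply: (tends_to_inj gY thY uxi veta); pose y0 := u 0%N.
apply/(boundary_equivP y0)/(inj_reflect inj).
- exact/boundary_equivP/tends_to_infinity/uxi.
- exact/boundary_equivP/tends_to_infinity/veta.
apply/boundary_equivP; apply: (tends_to_equiv gX thX (ct.1 _ _ uxi)); rewrite e.
exact: ct.1.
Qed.

Lemma base_rep (xi : boundary (coned_off A)) : exists u : nat -> Y, tends_to (baseY \o u) xi.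
Proof.
have [w wxi] := boundary_rep xi.
have [u hu] := @choice _ _ (fun k y => dist (w k) (baseY y) <= 1)
  (fun k => cone_near_base (w k)).
exists u; apply: (equiv_tends_to gYh thYh wxi).
apply/(boundary_equivP (w 0%N)) => r.
have [N hN] := proj1 (boundary_equivP (w 0%N) _ _) (tends_to_infinity wxi) (r + 1).
exists N => m n Nm Nn; have := hN _ _ Nm Nn; rewrite !(gromov_productC _ (w m)).
by have := gromov_product_move (w 0%N) (w n) (w m) (baseY (u n)); have := hu n; rewrite /=; lra.
Qed.

(** Equivalence of the images passes from the coned-off [X] to [X]; injectivity of [diota] reflects
    it to [Y], and [electric_diverge_converse] lifts it to the coned-off [Y]. *)
Lemma hat_of_injective : injective diota -> injective diotah.
Proof.
move=> inj xih etah e; have [u uxi] := base_rep xih; have [v veta] := base_rep etah.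
pose y0 := u 0%N.
have uh : diverge (baseY y0) (baseY \o u) (baseY \o u).
  exact/boundary_equivP/tends_to_infinity/uxi.
have vh : diverge (baseY y0) (baseY \o v) (baseY \o v).
  exact/boundary_equivP/tends_to_infinity/veta.
have down := electric_diverge gY thY K0 qcAY geoYh.
have [xi txi] := to_infinity_tends (proj2 (boundary_equivP _ _ _) (down _ _ _ uh)).
have [eta teta] := to_infinity_tends (proj2 (boundary_equivP _ _ _) (down _ _ _ vh)).
apply: (tends_to_inj gYh thYh uxi veta); apply/(boundary_equivP (baseY y0)).
apply: (electric_diverge_converse gY thY K0 qcAY geoYh thYh uh).
have xieta : xi = eta.
  apply: inj; apply: (tends_to_inj gX thX (ct.1 _ _ txi) (ct.1 _ _ teta)).
  apply/(boundary_equivP (iota y0))/(electric_diverge gX thX K0 qcB geoXh).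
  apply/boundary_equivP/(tends_to_equiv gXh thXh (cth.1 _ _ uxi)); rewrite e.
  exact: cth.1 _ _ veta.
apply/boundary_equivP/(tends_to_equiv gY thY txi); rewrite xieta; exact: teta.
Qed.

End Main.

(** * The hypotheses in terms of intervals, and the theorem *)

Lemma quasiconvex_interval (R : realType) (T : metricType R) (k : R) (A : set T) :
  geodesic_space T -> quasiconvex k A -> interval_quasiconvex (`|k| + 1) A.
Proof.
move=> gT qc a b q Aa Ab /(btw_in_segment gT)[S hS Sq].
exact: closed_nbhd_near (qc _ _ _ Aa Ab hS _ Sq).
Qed.

Lemma induced_length_lip (R : realType) (X Y : metricType R) (f : Y -> X) :
  induced_length_metric f -> forall y y', dist (f y) (f y') <= dist y y'.
Proof.
move=> len y y'; rewrite -lee_fin [X in (_ <= X)%E](len y y').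
apply/ereal_infP => _ [c [_ c0 c1 _] <-]; apply: ereal_sup_ubound.
(* The one-step partition bounds the length below by the chord. *)
exists [:: 1]; first by split => //=; rewrite ltr01.
by rewrite big_nat1 /= c0 c1.
Qed.

Lemma proper_embedding_bound (R : realType) (X Y : metricType R) (f : Y -> X)
    (rho : {nonneg R} -> {nonneg R}) : proper_embedding rho f ->
  forall M : R, exists r : R, forall y y', dist (f y) (f y') <= M -> dist y y' <= r.
Proof.
move=> prop M; have M0 : 0 <= Num.max M 0 by rewrite le_max lexx orbT.
exists (rho (NngNum M0))%:num => y y' h; apply: prop.
by apply: le_trans h _; rewrite /= le_max lexx.
Qed.

Lemma thinW (R : realType) (T : metricType R) (D D' : R) : D <= D' -> thin D T -> thin D' T.
Proof. by move=> DD h x y z p /(h _ _ z)[q ? ?]; exists q => //; exact: le_trans DD. Qed.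

Theorem theorem3p17 (R : realType) (X Y : metricType R) (iota : Y -> X)
    (delta0 k0 : R) (rho0 : {nonneg R} -> {nonneg R})
    (iota_inj : injective iota)
    (hypX : hyperbolic delta0 X) (hypY : hyperbolic delta0 Y)
    (lenY : induced_length_metric iota)
    (properY : proper_embedding rho0 iota)
    (I : Type) (B : I -> set X)
    (locfinB : locally_finite B)
    (qcB : forall i, quasiconvex k0 (B i))
    (J : Type) (A : J -> set Y)
    (phi : J -> I) (subAB : forall j, iota @` A j `<=` B (phi j))
    (qcAX : forall j, quasiconvex k0 (iota @` A j))
    (qcAY : forall j, quasiconvex k0 (A j))
    (hypXh : exists delta, hyperbolic delta (coned_off B))
    (hypYh : exists delta, hyperbolic delta (coned_off A))
    (mitra : mitra_criterion (coned_map subAB)) :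
  [/\ admits_CT_map iota,
      admits_CT_map (coned_map subAB)
    & forall (diota : boundary Y -> boundary X)
             (diotah : boundary (coned_off A) -> boundary (coned_off B)),
        is_CT_map iota diota -> is_CT_map (coned_map subAB) diotah ->
        (injective diota <-> injective diotah)].
Proof.
have [geoX _] := hypX; have [geoY _] := hypY.
have [deltaX hypXh'] := hypXh; have [geoXh _] := hypXh'.
have [deltaY hypYh'] := hypYh; have [geoYh _] := hypYh'.
pose Dh := Num.max (`|deltaX| + 1) (`|deltaY| + 1).
have thXh : thin Dh (coned_off B).
  by apply: thinW (hyperbolic_thin hypXh'); rewrite le_max lexx.
have thYh : thin Dh (coned_off A).
  by apply: thinW (hyperbolic_thin hypYh'); rewrite le_max lexx orbT.
have thX := hyperbolic_thin hypX; have thY := hyperbolic_thin hypY.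
have lip := induced_length_lip lenY; have proper := proper_embedding_bound properY.
have K0 : 0 <= `|k0| + 1 by rewrite addr_ge0.
have qcB' i := quasiconvex_interval geoX (qcB i).
have qcAY' j := quasiconvex_interval geoY (qcAY j).
have qcAX' j := quasiconvex_interval geoX (qcAX j).
have far_hat := mitra_far_proper geoXh geoYh mitra.
have gX := geodesic_geod geoX; have gY := geodesic_geod geoY.
have gXh := geodesic_geod geoXh; have gYh := geodesic_geod geoYh.
have far_iota := iota_far_proper geoX geoY thX thY lip proper K0 qcB' qcAY' qcAX'
  geoXh geoYh far_hat.
split.
- exact: far_proper_CT gX thX gY thY far_iota.
- exact: far_proper_CT gXh thXh gYh thYh far_hat.
move=> diota diotah ct cth; split.
  exact: (hat_of_injective geoX geoY thX thY K0 qcB' qcAY' geoXh geoYh thXh thYh ct cth).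
exact: (injective_of_hat geoX geoY thX thY lip proper K0 qcB' qcAY' qcAX' geoXh geoYh
  thXh thYh far_hat ct cth).
Qed.
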